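(* Let $m\ge3$, $0\le r\le n$ be integers and let $p$ be $0$ or a prime. Let $A_1,\dots,A_m\subseteq[n]$ be sets of size at most $r$, and set $E=\bigcup_{i=1}^m\{i\}\times A_i\subseteq[m]\times[n]$. For $k\in\{1,2,3\}$, let $S_k$ be the set of $j\in[n]$ which appear in exactly $k$ of the sets $A_i$. Then $E$ is independent in $\mathrm{T}_{m,n}(3,r,p)$ if and only if all of the following hold: \begin{align*} |A_i\cap A_j\cap A_k\cap A_\ell| &= 0 && \text{for all distinct } i,j,k,\ell\in[m],\\ |A_i\setminus S_3|+|S_3| &\le r && \text{for all } i\in[m],\\ |(A_i\cap A_j)\setminus S_3|+|(A_k\cap A_\ell)\setminus S_3|+|S_3| &\le r && \text{for all distinct } i,j,k,\ell\in[m],\\ |A_i\setminus S_3|+|A_j\setminus S_3|+|S_2\setminus(S_3\cup A_i\cup A_j)|+2|S_3| &\le 2r && \text{for all distinct } i,j\in[m],\\ |S_1|+2|S_2|+3|S_3| &\le 3r. \end{align*}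
   Context: Write $[n]=\{1,\dots,n\}$. For integers $0\le s\le m$, $0\le r\le n$ and $p$ equal to $0$ or a prime, the tensor matroid $\mathrm{T}_{m,n}(s,r,p)$ is the following matroid on $[m]\times[n]$. Let $K$ be a field of characteristic $p$ and let $u_1,\dots,u_m\in K^s$, $v_1,\dots,v_n\in K^r$ be vectors all of whose coordinates together are algebraically independent over the prime field. A set $E\subseteq[m]\times[n]$ is independent if and only if the vectors $u_i\otimes v_j$, indexed by $(i,j)\in E$, are linearly independent in $K^s\otimes K^r$. This matroid depends only on $m,n,s,r,p$. *)

(* Defs.v *)
From mathcomp Require Export all_boot all_order all_algebra.
From mathcomp Require Export mxtens.
From mathcomp.multinomials Require Export mpoly.
Set Implicit Arguments.
Unset Strict Implicit.
Unset Printing Implicit Defensive.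
Import GRing.Theory.
Local Open Scope ring_scope.

(* Membership in [pchar K] forces p to be prime. *)
Definition has_char (K : fieldType) (p : nat) : Prop :=
  if p == 0%N then [pchar K] =i pred0 else p \in [pchar K].

(* Subfields are Prop-valued predicates because the prime subfield of an
   abstract fieldType has no boolean membership test. As x / 0 = 0, the last
   clause is harmless for y = 0. *)
Definition is_subfield (K : fieldType) (S : K -> Prop) : Prop :=
  [/\ S 1, forall x y, S x -> S y -> S (x - y)
    & forall x y, S x -> S y -> S (x / y)].

Definition prime_subfield (K : fieldType) (x : K) : Prop :=
  forall S : K -> Prop, is_subfield S -> S x.

Definition alg_independent_over (K : fieldType) (F : K -> Prop)
    (N : nat) (x : 'rV[K]_N) : Prop :=
  forall P : {mpoly K[N]},
    (forall mon : 'X_{1..N}, F P@_mon) -> P.@[fun i => x 0 i] = 0 -> P = 0.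

(* The vectors u_i are the rows of U and the vectors v_j the rows of V. *)
Definition generic_vectors (K : fieldType) (m n s r : nat)
    (U : 'M[K]_(m, s)) (V : 'M[K]_(n, r)) : Prop :=
  alg_independent_over (@prime_subfield K) (row_mx (mxvec U) (mxvec V)).

(* K^s (x) K^r is identified with K^(s * r) through the Kronecker product.
   [free] is applied to the sequence indexed by the elements of E, so repeated
   vectors count as dependent. *)
Definition tensor_indep (K : fieldType) (m n s r : nat)
    (U : 'M[K]_(m, s)) (V : 'M[K]_(n, r)) (E : {set 'I_m * 'I_n}) : bool :=
  free [seq (row ij.1 U *t row ij.2 V : 'rV[K]_(s * r)) | ij <- enum E].

Definition union_rows (m n : nat) (A : 'I_m -> {set 'I_n}) :
    {set 'I_m * 'I_n} :=
  \bigcup_(i : 'I_m) setX [set i] (A i).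

Definition in_exactly (m n : nat) (A : 'I_m -> {set 'I_n}) (k : nat) :
    {set 'I_n} :=
  [set j | #|[set i | j \in A i]| == k].

(* Main.v *)
(* The tensors u_i (x) v_j, (i, j) in E, are independent iff the spaces
   L_j (x) v_j are and each L_j, the span of the u_i with j in A_i, has the
   expected dimension.

   Necessity: four vectors of K^3 are dependent, which gives the first condition;
   each of the others is the count "sum over j of dim (L_j meet W) <= r dim W" for
   a subspace W of K^3, namely the line of u_i, the intersection of <u_i, u_j> and
   <u_k, u_l>, the plane <u_i, u_j>, and K^3.

   Sufficiency: independence is the nonvanishing of a minor, so it is enough to
   find one matrix V that works for the generic U.  Give distinct basis vectors
   of K^r to the columns of S_3 and to as many columns of S_2 as fit ("slots"),
   and let f_h be the linear form with kernel L_h for a slot h of S_2.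
   If S_2 fits, the columns of S_1 must be independent in the sum of the quotients
   K^3 / L_h and of the copies of K^3 in the unused coordinates.  Otherwise there
   is one form f_h per remaining coordinate, and the restrictions of the f_h to
   the other L_j, rescaled by coefficients depending on h and j, must be
   independent.  Both are existence statements about independent representatives
   of subspaces, settled by Rado's theorem; its Hall-type condition is exactly
   what the hypotheses provide. *)
Require Import Defs.
From HB Require Import structures.
From mathcomp Require Import ring zify.
Set Implicit Arguments.
Unset Strict Implicit.
Unset Printing Implicit Defensive.
Import GRing.Theory.
Local Open Scope ring_scope.

(** * Independent representatives of subspaces *)

(** The subspace [Z] makes Rado's theorem fit for induction: the representatives are independent
    modulo [Z]. A tight proper subset is served first and its whole span is absorbed into [Z]; if
    there is none, a single index is served. *)
Lemma rado_subspaces (F : fieldType) (vT : vectType F) (I : finType)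
    (P : {set I}) (Z : {vspace vT}) (Y : I -> {vspace vT}) :
  (forall Q : {set I}, Q \subset P ->
     \dim Z + #|Q| <= \dim (Z + \sum_(i in Q) Y i))%N ->
  exists2 y : I -> vT, forall i, i \in P -> y i \in Y i &
    (\dim Z + #|P| <= \dim (Z + \sum_(i in P) <[y i]>))%N.
Proof.
have [k leP] := ubnP #|P|; elim: k => // k IH in P leP Z Y *.
move=> hall.
have [->|[i0 i0P]] := set_0Vmem P.
  by exists (fun=> 0) => [i|]; rewrite ?inE // cards0 addn0 dimvS // addvSl.
have [/existsP[Q /and3P[QP Q0 tight]]|/existsPn ntight] := boolP [exists Q : {set I},
   [&& Q \proper P, Q != set0 &
     \dim (Z + \sum_(i in Q) Y i) <= \dim Z + #|Q|]]%N.
- have sQP := proper_sub QP.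
  have ltQP := proper_card QP.
  have [||y1 y1Y y1D] := IH Q _ Z Y.
  + exact: leq_trans ltQP _.
  + by move=> Q' sQ'; apply: hall; apply: subset_trans sQ' sQP.
  (* Tightness forces the representatives of [Q] to span all of [Z1], so the other indices can be
     treated modulo [Z1]. *)
  set Z1 := (Z + \sum_(i in Q) Y i)%VS in tight.
  have eZ1 : (Z + \sum_(i in Q) <[y1 i]>)%VS = Z1.
    apply/eqP; rewrite eqEdim (leq_trans tight y1D) andbT.
    apply: addvS => //; apply/subv_sumP => i iQ.
    by rewrite (sumv_sup i) // -memvE y1Y.
  have dZ1 : (\dim Z1 = \dim Z + #|Q|)%N.
    by apply/eqP; rewrite eqn_leq tight hall.
  have cPQ : (#|P :\: Q| + #|Q| = #|P|)%N.
    by rewrite -(cardsID Q P) (setIidPr sQP) addnC.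
  have splitP (P' : {set I}) (W : I -> {vspace vT}) : P' \subset P :\: Q ->
      (\sum_(i in Q :|: P') W i = \sum_(i in Q) W i + \sum_(i in P') W i)%VS.
    move=> sP'; rewrite (big_setID Q) /= setUK; congr (_ + _)%VS.
    apply: eq_bigl => i; rewrite !inE; case: (boolP (i \in Q)) => //= iQ.
    by apply/esym/negbTE/negP => /(subsetP sP'); rewrite inE iQ.
  have [||y2 y2Y y2D] := IH (P :\: Q) _ Z1 Y.
  + have : (0 < #|Q|)%N by rewrite card_gt0.
    by lia.
  (* For [Q'], the condition modulo [Z1] is the original condition for the union of [Q] and [Q']. *)
  + move=> Q' sQ'; rewrite dZ1 /Z1 -addvA -splitP // -addnA.
    have -> : (#|Q| + #|Q'| = #|Q :|: Q'|)%N.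
      rewrite cardsU (_ : Q :&: Q' = set0) ?cards0 ?subn0 //.
      apply/setP => i; rewrite !inE; apply/negbTE/negP.
      by move=> /andP[iQ /(subsetP sQ')]; rewrite inE iQ.
    apply: hall; rewrite subUset sQP /=.
    by apply: subset_trans sQ' _; apply: subsetDl.
  exists (fun i => if i \in Q then y1 i else y2 i) => [i iP|].
    by case: ifP => iQ; [apply: y1Y | apply: y2Y; rewrite inE iQ].
  have eP : Q :|: setD P Q = P.
    by apply/setP => i; rewrite !inE; case: (boolP (i \in Q)) => // /(subsetP sQP).
  rewrite -[in X in (_ <= X)%N]eP.
  rewrite splitP // addvA.
  have -> : (\sum_(i in Q) <[if i \in Q then y1 i else y2 i]> =
             \sum_(i in Q) <[y1 i]>)%VS by apply: eq_bigr => i ->.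
  have -> : (\sum_(i in (P :\: Q)%SET) <[if i \in Q then y1 i else y2 i]> =
             \sum_(i in (P :\: Q)%SET) <[y2 i]>)%VS.
    by apply: eq_bigr => i; rewrite inE => /andP[/negbTE->].
  rewrite eZ1; apply: leq_trans y2D.
  rewrite dZ1 -addnA leq_add2l; lia.
(* No proper nonempty [Q] is tight, so any vector of [Y i0] outside [Z] may be
   chosen: each dimension drops by at most one. *)
- have : ~~ (Y i0 <= Z)%VS.
    apply/negP => sYZ; have := hall [set i0].
    rewrite sub1set i0P big_set1 cards1 => /(_ isT).
    by rewrite (addv_idPl sYZ) addn1 ltnn.
  case/subvPn => y0 y0Y y0Z.
  have dZ1 : (\dim (Z + <[y0]>) = \dim Z + 1)%N.
    rewrite dimv_disjoint_sum ?dim_vline; first by case: eqP y0Z => // ->; rewrite mem0v.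
    apply/eqP; rewrite -subv0; apply/subvP => v /memv_capP[vZ /vlineP[a va]].
    have [a0|a0] := eqVneq a 0; first by rewrite va a0 scale0r mem0v.
    by case/negP: y0Z; rewrite -(scale1r y0) -(mulVf a0) -scalerA -va memvZ.
  have cP := cardsD1 i0 P; rewrite i0P in cP.
  have [||y yY yD] := IH (P :\ i0) _ (Z + <[y0]>)%VS Y.
  + by lia.
  + move=> Q sQ; have [->|Q0] := eqVneq Q set0.
      by rewrite cards0 addn0 dimvS // addvSl.
    rewrite dZ1.
    have sQP : Q \subset P by apply: subset_trans sQ (subsetDl _ _).
    have pQP : Q \proper P.
      apply/properP; split => //; exists i0 => //.
      by apply/negP => /(subsetP sQ); rewrite !inE eqxx.
    have := ntight Q; rewrite pQP Q0 /= -ltnNge => lt.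
    rewrite -addnA add1n addnS; apply: (leq_trans lt).
    by rewrite dimvS // addvS // addvSl.
  exists (fun i => if i == i0 then y0 else y i) => [i iP|].
    by case: eqP => [->//|/eqP ne]; apply: yY; rewrite !inE ne.
  rewrite (big_setD1 i0) //= eqxx addvA.
  have -> : (\sum_(i in P :\ i0) <[if i == i0 then y0 else y i]> =
             \sum_(i in P :\ i0) <[y i]>)%VS.
    by apply: eq_bigr => i; rewrite !inE => /andP[/negbTE->].
  apply: leq_trans yD; rewrite dZ1; lia.
Qed.

(** * Representatives obtained by rescaling blocks of coordinates *)

Section Blocks.
Variables (F : fieldType) (I X J : finType) (beta : X -> J) (g : I -> X -> F).

Definition block_vector (j : J) (i : I) : {ffun X -> F^o} :=
  [ffun x => if beta x == j then g i x else 0].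

Definition block_rank (Q : {set I}) (j : J) : nat :=
  \dim (\sum_(i in Q) <[block_vector j i]>).

Lemma block_rank_ge (Q : {set I}) (j : J) (s : nat) (f : 'I_s -> I) :
  (forall a, f a \in Q) ->
  (forall l : 'I_s -> F,
     (forall x, beta x = j -> \sum_a l a * g (f a) x = 0) ->
     forall a, l a = 0) ->
  (s <= block_rank Q j)%N.
Proof.
move=> fQ indep.
pose t := [tuple block_vector j (f a) | a < s].
have ft : free t.
  apply/freeP => l l0; apply: indep => x bx.
  move/ffunP: l0 => /(_ x); rewrite ffunE sum_ffunE; apply: etrans.
  apply: eq_bigr => a _.
  by rewrite !ffunE -tnth_nth tnth_mktuple ffunE bx eqxx.
have <- : \dim <<t>> = s by rewrite -[RHS](size_tuple t); apply/eqP.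
apply: dimvS; apply/span_subvP => v /mapP[a _ ->].
by rewrite memvE (sumv_sup (f a)).
Qed.

(** Rado's theorem for the spaces [Y i] spanned by the block parts of the rows. Blocks have disjoint
    supports, so the sum of the [Y i] over [Q] is direct over the blocks and its dimension is the
    sum of the block ranks. A vector of [Y i] is row [i] with each block [j] rescaled by some
    [c i j]. *)
Lemma rado_blocks (P : {set I}) :
  (forall Q : {set I}, Q \subset P -> #|Q| <= \sum_j block_rank Q j)%N ->
  exists c : I -> J -> F, forall l : I -> F,
    (forall x, \sum_(i in P) l i * (c i (beta x) * g i x) = 0) ->
    forall i, i \in P -> l i = 0.
Proof.
move=> hall.
pose Y i := (\sum_j <[block_vector j i]>)%VS.
have dimY (Q : {set I}) : (\dim (\sum_(i in Q) Y i) = \sum_j block_rank Q j)%N.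
  rewrite /Y exchange_big /=.
  apply/eqP; rewrite -/(directv (\sum_j (\sum_(i in Q) <[block_vector j i]>))).
  apply/directv_sum_independent => us usV us0 j _.
  have sup k x : beta x != k -> us k x = 0.
    move=> bx; have /memv_sumP[w wV ->] := usV k isT.
    rewrite sum_ffunE big1 // => i iQ.
    by have /vlineP[a ->] := wV i iQ; rewrite !ffunE (negbTE bx) scaler0.
  apply/ffunP => x; rewrite ffunE; have [bx|/sup //] := eqVneq (beta x) j.
  move/ffunP: us0 => /(_ x); rewrite sum_ffunE ffunE (bigD1 j) //=.
  rewrite big1 ?addr0 // => k kj; apply: sup; rewrite bx eq_sym //.
have [|y yY yD] := @rado_subspaces F _ I P 0%VS Y.
  by move=> Q QP; rewrite dimv0 add0n add0v dimY hall.
have cP i : exists ci : J -> F, i \in P -> y i = \sum_j ci j *: block_vector j i.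
  have [iP|niP] := boolP (i \in P); last by exists (fun=> 0).
  have /memv_sumP[w wV ->] := yY i iP.
  have /fin_all_exists[ci ciP] : forall j, exists a, w j = a *: block_vector j i.
    by move=> j; have /vlineP[a ->] := wV j isT; exists a.
  by exists ci => _; apply: eq_bigr => j _; rewrite ciP.
have /fin_all_exists[c cE] := cP.
exists c => l l0.
have yl : \sum_(i in P) l i *: y i = 0.
  apply/ffunP => x; rewrite sum_ffunE ffunE -[RHS](l0 x); apply: eq_bigr => i iP.
  rewrite !ffunE cE // sum_ffunE (bigD1 (beta x)) //= big1 ?addr0 => [|j jx].
    by rewrite !ffunE eqxx.
  by rewrite !ffunE eq_sym (negbTE jx) scaler0.
(* If [l i0] were nonzero, [y i0] would lie in the span of the other representatives, whose
   dimension is less than [#|P|]. *)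
move=> i0 i0P; apply/eqP; apply: contraT => li0.
move: yD; rewrite dimv0 add0v add0n (big_setD1 i0) //= (_ : (_ + _)%VS = \sum_(i in P :\ i0) <[y i]>)%VS.
  move=> /leq_trans/(_ (dimv_leq_sum _ _ _)).
  rewrite (cardsD1 i0) i0P; rewrite leqNgt => /negP[]; rewrite add1n ltnS.
  by rewrite -sum1_card leq_sum // => i _; rewrite dim_vline leq_b1.
apply/addv_idPr; rewrite -memvE.
have -> : y i0 = - (l i0)^-1 *: \sum_(i in P :\ i0) l i *: y i.
  move: yl; rewrite (big_setD1 i0) //= => /eqP; rewrite addrC addr_eq0 => /eqP->.
  by rewrite scalerN scaleNr opprK scalerA mulVf // scale1r.
apply/memvZ/memv_suml => i iP; apply/memvZ.
by rewrite memvE (sumv_sup i).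
Qed.
End Blocks.

(** * Specialization of generic vectors *)

(** The base is a ring, not a field, so that the matrix can also be formed from indeterminates. *)
Definition tensor_mx (R : comNzRingType) (m n s r : nat)
    (U : 'M[R]_(m, s)) (V : 'M[R]_(n, r)) (E : {set 'I_m * 'I_n}) :
    'M[R]_(#|E|, s * r) :=
  \matrix_(e, x) (U (enum_val e).1 (mxtens_unindex x).1 *
                  V (enum_val e).2 (mxtens_unindex x).2).

Lemma map_tensor_mx (R S : comNzRingType) (f : {rmorphism R -> S}) (m n s r : nat)
    (U : 'M[R]_(m, s)) (V : 'M[R]_(n, r)) (E : {set 'I_m * 'I_n}) :
  map_mx f (tensor_mx U V E) = tensor_mx (map_mx f U) (map_mx f V) E.
Proof. by apply/matrixP => e x; rewrite !mxE rmorphM. Qed.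

Section TensorIndep.
Variables (K : fieldType) (m n s r : nat) (U : 'M[K]_(m, s)) (V : 'M[K]_(n, r)).
Variable E : {set 'I_m * 'I_n}.

Lemma tensor_indep_row_free : tensor_indep U V E = row_free (tensor_mx U V E).
Proof.
pose f (ij : 'I_m * 'I_n) := (row ij.1 U *t row ij.2 V : 'rV[K]_(s * r)).
have eqt : [seq f ij | ij <- enum E] = [tuple f (enum_val e) | e < #|E|].
  apply: (@eq_from_nth _ 0) => [|i]; rewrite size_map -cardE ?size_tuple // => iE.
  case: (set_0Vmem E) => [E0|[x0 _]]; first by rewrite E0 cards0 in iE.
  rewrite (nth_map x0) -?cardE //.
  by rewrite -(tnth_nth 0 _ (Ordinal iE)) tnth_mktuple (enum_val_nth x0).
rewrite /tensor_indep -/f eqt.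
have rowE e : row e (tensor_mx U V E) = f (enum_val e).
  by apply/rowP => x; rewrite !mxE.
apply/freeP/idP => [fr|/row_free_inj inj k k0 e].
  rewrite -kermx_eq0; apply/rowV0P => c /sub_kermxP; rewrite mulmx_sum_row => c0.
  apply/rowP => e; rewrite mxE; apply: fr => {e}; apply: etrans c0.
  by apply: eq_bigr => e _; rewrite -tnth_nth tnth_mktuple rowE.
have /rowP/(_ e) : \row_i k i = 0; last by rewrite !mxE.
apply: (inj 1%N); rewrite mul0mx mulmx_sum_row; apply: etrans k0.
by apply: eq_bigr => i _; rewrite -tnth_nth tnth_mktuple rowE mxE.
Qed.

(** The working form of independence: coefficients are arrays over all pairs, zero off [E], so that
    sums over rows and columns can be exchanged freely. *)
Lemma tensor_indepP :
  tensor_indep U V E <->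
  forall C : 'I_m -> 'I_n -> K,
    (forall i j, (i, j) \notin E -> C i j = 0) ->
    (forall a b, \sum_i \sum_j C i j * (U i a * V j b) = 0) ->
    forall i j, C i j = 0.
Proof.
rewrite tensor_indep_row_free.
have sumE (C : 'I_m -> 'I_n -> K) a b : (forall i j, (i, j) \notin E -> C i j = 0) ->
    \sum_i \sum_j C i j * (U i a * V j b) =
    ((\row_(e < #|E|) C (enum_val e).1 (enum_val e).2) *m tensor_mx U V E) 0 (mxtens_index (a, b)).
  move=> suppC; rewrite pair_big /= mxE (bigID (mem E)) /= [X in _ + X]big1 ?addr0.
    rewrite big_enum_val /=; apply: eq_bigr => e _.
    by rewrite !mxE mxtens_indexK.
  by case=> i j /suppC /= ->; rewrite mul0r.
split=> [/row_free_inj inj C suppC C0 i j|indep].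
  have [ijE|/suppC //] := boolP ((i, j) \in E).
  have c0 : (\row_e C (enum_val e).1 (enum_val e).2 : 'rV_#|E|) = 0.
    apply: (inj 1%N); rewrite mul0mx; apply/rowP => x.
    by case: (mxtens_indexP x) => a b; rewrite -sumE // C0 mxE.
  move/rowP: c0 => /(_ (enum_rank_in ijE (i, j))).
  by rewrite !mxE enum_rankK_in.
rewrite -kermx_eq0; apply/rowV0P => c /sub_kermxP c0.
(* The sum has at most one term: the coefficient at [(i, j)], or 0 off [E]. *)
pose C i j := \sum_(e | enum_val e == (i, j)) c 0 e.
have CE e : C (enum_val e).1 (enum_val e).2 = c 0 e.
  rewrite /C (big_pred1 e) // => e'; rewrite -surjective_pairing.
  by rewrite (inj_eq enum_val_inj).
have suppC i j : (i, j) \notin E -> C i j = 0.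
  move=> nE; rewrite /C big_pred0 // => e; apply/negbTE; apply: contra nE => /eqP <-.
  exact: enum_valP.
apply/rowP => e; rewrite mxE -CE; apply: indep => // a b.
rewrite sumE // (_ : (\row_e _ : 'rV_#|E|) = c) ?c0 ?mxE //.
by apply/rowP => e'; rewrite mxE CE.
Qed.
End TensorIndep.

(** * Polynomials with coefficients in the prime subfield *)

Section PrimeCoefficients.
Variables (K : fieldType) (N : nat).
Implicit Types P Q : {mpoly K[N]}.

Definition prime_coefs P : Prop := forall mon, prime_subfield P@_mon.

Lemma prime_subfield1 : prime_subfield (1 : K).
Proof. by move=> S []. Qed.
Lemma prime_subfieldB (x y : K) :
  prime_subfield x -> prime_subfield y -> prime_subfield (x - y).
Proof. by move=> px py S sS; have [_ SB _] := sS; apply: SB; [apply: px|apply: py]. Qed.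
Lemma prime_subfield0 : prime_subfield (0 : K).
Proof. rewrite -(subrr 1); apply: prime_subfieldB; exact: prime_subfield1. Qed.
Lemma prime_subfieldD (x y : K) :
  prime_subfield x -> prime_subfield y -> prime_subfield (x + y).
Proof.
move=> px py; rewrite -(opprK y) -[- y]sub0r; do !apply: prime_subfieldB => //.
exact: prime_subfield0.
Qed.
Lemma prime_subfieldM (x y : K) :
  prime_subfield x -> prime_subfield y -> prime_subfield (x * y).
Proof.
move=> px py S sS; have [S1 _ SV] := sS; rewrite -(invrK y) -[y^-1]mul1r.
by apply: (SV); [apply: px | apply: SV => //; apply: py].
Qed.

Lemma prime_coefsB P Q : prime_coefs P -> prime_coefs Q -> prime_coefs (P - Q).
Proof. by move=> pP pQ mon; rewrite mcoeffB; apply: prime_subfieldB. Qed.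
Lemma prime_coefsD P Q : prime_coefs P -> prime_coefs Q -> prime_coefs (P + Q).
Proof. by move=> pP pQ mon; rewrite mcoeffD; apply: prime_subfieldD. Qed.
Lemma prime_coefs_nat (b : bool) : prime_coefs b%:R.
Proof.
move=> mon; case: b; rewrite ?mcoeff1 ?mcoeff0; last exact: prime_subfield0.
by case: eqP => _; [exact: prime_subfield1 | exact: prime_subfield0].
Qed.
Lemma prime_coefsM P Q : prime_coefs P -> prime_coefs Q -> prime_coefs (P * Q).
Proof.
move=> pP pQ mon; rewrite mcoeffM.
apply: (big_ind (@prime_subfield K)) => [||k _]; first exact: prime_subfield0.
  exact: prime_subfieldD.
exact: prime_subfieldM.
Qed.
Lemma prime_coefsX i : prime_coefs 'X_i.
Proof.
move=> mon; rewrite mcoeffX.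
by case: eqP => _; [exact: prime_subfield1 | exact: prime_subfield0].
Qed.
Lemma prime_coefs_det k (M : 'M[{mpoly K[N]}]_k) :
  (forall i j, prime_coefs (M i j)) -> prime_coefs (\det M).
Proof.
move=> pM; apply: (big_ind prime_coefs) => [||p _].
- exact: (prime_coefs_nat false).
- exact: prime_coefsD.
rewrite /determinant; apply: prime_coefsM; last first.
  apply: (big_ind prime_coefs) => //; first exact: (prime_coefs_nat true).
  exact: prime_coefsM.
case: (perm.odd_perm p); last by rewrite expr0; exact: (prime_coefs_nat true).
rewrite expr1 -sub0r; apply: prime_coefsB; [exact: (prime_coefs_nat false)|exact: (prime_coefs_nat true)].
Qed.

Lemma alg_independent_neq0 (x y : 'rV[K]_N) P :
  alg_independent_over (@prime_subfield K) x -> prime_coefs P ->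
  P.@[fun i => y 0 i] != 0 -> P.@[fun i => x 0 i] != 0.
Proof.
move=> ind pP; apply: contra => /eqP Px.
by rewrite (ind P pP Px) meval0.
Qed.
End PrimeCoefficients.

Section Specialization.
Variables (K : fieldType) (m n s r : nat).
Let N := (m * s + n * r)%N.

(** The indeterminates are numbered in the order in which [generic_vectors] lists the coordinates of
    [U] and then of [V]. *)
Definition mpoly_U : 'M[{mpoly K[N]}]_(m, s) :=
  \matrix_(i, a) 'X_(lshift (n * r) (mxvec_index i a)).
Definition mpoly_V : 'M[{mpoly K[N]}]_(n, r) :=
  \matrix_(j, b) 'X_(rshift (m * s) (mxvec_index j b)).

Definition eval_at (U : 'M[K]_(m, s)) (V : 'M[K]_(n, r)) : {mpoly K[N]} -> K :=
  meval (fun i => (row_mx (mxvec U) (mxvec V)) 0 i).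
HB.instance Definition _ U V := GRing.RMorphism.on (eval_at U V).

Lemma eval_at_U U V : map_mx (eval_at U V) mpoly_U = U.
Proof. by apply/matrixP => i a; rewrite !mxE /eval_at mevalXU row_mxEl mxvecE. Qed.
Lemma eval_at_V U V : map_mx (eval_at U V) mpoly_V = V.
Proof. by apply/matrixP => i a; rewrite !mxE /eval_at mevalXU row_mxEr mxvecE. Qed.

Lemma eval_atD U V P Q : eval_at U V (P + Q) = eval_at U V P + eval_at U V Q.
Proof. exact: rmorphD. Qed.
Lemma eval_atB U V P Q : eval_at U V (P - Q) = eval_at U V P - eval_at U V Q.
Proof. exact: rmorphB. Qed.
Lemma eval_atM U V P Q : eval_at U V (P * Q) = eval_at U V P * eval_at U V Q.
Proof. exact: rmorphM. Qed.

Variables (U : 'M[K]_(m, s)) (V : 'M[K]_(n, r)).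
Hypothesis gUV : generic_vectors U V.

Lemma generic_eval_neq0 U' V' (P : {mpoly K[N]}) :
  prime_coefs P -> eval_at U' V' P != 0 -> eval_at U V P != 0.
Proof. exact: alg_independent_neq0. Qed.

(** Independence at [(U', V')] means that some maximal minor is nonzero there. That minor is a
    polynomial with coefficients in the prime subfield; being a nonzero polynomial, it cannot vanish
    at the generic point. *)
Lemma generic_tensor_indep (U' : 'M[K]_(m, s)) (V' : 'M[K]_(n, r)) (E : {set 'I_m * 'I_n}) :
  tensor_indep U' V' E -> tensor_indep U V E.
Proof.
rewrite !tensor_indep_row_free => fr.
(* After transposing, [f] selects the columns of a maximal minor that is nonzero at [(U', V')]. *)
have full : row_full (tensor_mx U' V' E)^T by rewrite /row_full mxrank_tr.
pose f := fullrankfun full.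
pose P := \det (rowsub f (tensor_mx mpoly_U mpoly_V E)^T).
have evalP U1 V1 : eval_at U1 V1 P = \det (rowsub f (tensor_mx U1 V1 E)^T).
  rewrite -det_map_mx; congr (\det _).
  have := map_tensor_mx (eval_at U1 V1) mpoly_U mpoly_V E.
  rewrite eval_at_U eval_at_V => <-.
  by apply/matrixP => i j; rewrite !mxE.
have : eval_at U V P != 0.
  apply: (@generic_eval_neq0 U' V').
    apply: prime_coefs_det => i j; rewrite !mxE.
    by apply: prime_coefsM; apply: prime_coefsX.
  by rewrite evalP -unitfE -unitmxE fullrowsub_unit.
rewrite evalP -unitfE -unitmxE -row_full_unit => /eqP rk.
rewrite /row_free -mxrank_tr eqn_leq rank_leq_col /=.
by rewrite -{1}rk mxrankS // rowsub_sub.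
Qed.
End Specialization.

(** * Points and lines in general position *)

Notation o0 := (@Ordinal 3 0 isT).
Notation o1 := (@Ordinal 3 1 isT).
Notation o2 := (@Ordinal 3 2 isT).

Lemma ord3_ind (P : 'I_3 -> Prop) : P o0 -> P o1 -> P o2 -> forall a, P a.
Proof.
move=> P0 P1 P2 a; suff: [\/ a = o0, a = o1 | a = o2] by case=> ->.
by case: a => [[|[|[|//]]] lt]; constructor; apply: val_inj.
Qed.

(** The determinant is written out so that [ring] proves the identities between brackets. *)
Definition det3 (R : comNzRingType) (x y z : 'I_3 -> R) : R :=
  x o0 * (y o1 * z o2 - y o2 * z o1) - x o1 * (y o0 * z o2 - y o2 * z o0)
  + x o2 * (y o0 * z o1 - y o1 * z o0).

(** Expansion of a 4 by 4 determinant with a repeated row of coordinates: the linear relation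
    between four vectors of 3-space. *)
Lemma det3_cramer (R : comNzRingType) (x y z w : 'I_3 -> R) t :
  det3 y z w * x t - det3 x z w * y t + det3 x y w * z t - det3 x y z * w t = 0.
Proof. by elim/ord3_ind: t; rewrite /det3; ring. Qed.

Section Bracket.
Variables (R : comNzRingType) (m : nat) (U : 'M[R]_(m, 3)).

Definition bracket (i j k : 'I_m) : R := det3 (U i) (U j) (U k).

(* Vanishes iff the lines through a, b, through c, d and through e, f in the
   projective plane are concurrent. *)
Definition concurrency (a b c d e f : 'I_m) : R :=
  bracket a b e * bracket c d f - bracket a b f * bracket c d e.

Lemma bracket_plucker i j k l t :
  bracket j k l * U i t - bracket i k l * U j t + bracket i j l * U k t
    - bracket i j k * U l t = 0.
Proof. exact: det3_cramer. Qed.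

Lemma bracket_sumr (x y : 'I_3 -> R) (c : 'I_m -> R) :
  det3 x y (fun t => \sum_i c i * U i t) = \sum_i c i * det3 x y (U i).
Proof.
rewrite /det3 /= !mulr_sumr -!sumrB !mulr_sumr -!sumrB -!big_split /=.
by apply: eq_bigr => i _; ring.
Qed.
End Bracket.

Section GeneralPosition.
Variables (K : fieldType) (m : nat) (U : 'M[K]_(m, 3)).

(** Apart from the final passage from a special [V] to the generic one, this is all that is used
    about the [u_i]. Six distinct indices suffice in the second clause, since with a shared index
    [concurrency] factors into brackets. *)
Definition general_position : Prop :=
  (forall i j k, uniq [:: i; j; k] -> bracket U i j k != 0) /\
  (forall a b c d e f, uniq [:: a; b; c; d; e; f] ->
     concurrency U a b c d e f != 0).

Hypothesis gU : general_position.

Lemma bracket_neq0 i j k : i != j -> i != k -> j != k -> bracket U i j k != 0.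
Proof. by move=> ij ik jk; apply: gU.1; rewrite /= !inE negb_or ij ik jk. Qed.

Definition nonconcurrent_edges (a b c d e f : 'I_m) : Prop :=
  [/\ [/\ a != b, c != d & e != f],
    [/\ [set a; b] != [set c; d], [set a; b] != [set e; f] &
        [set c; d] != [set e; f]] &
    [set a; b] :&: [set c; d] :&: [set e; f] = set0].

(** Pairs are edges on the vertex set [[m]]. If two of the three edges share a vertex, [concurrency]
    is, up to sign, a product of two brackets, nonzero because the third edge avoids that vertex and
    the edges differ. If no vertex is shared, general position applies directly. *)
Lemma concurrency_neq0 a b c d e f :
  nonconcurrent_edges a b c d e f -> concurrency U a b c d e f != 0.
Proof.
have b0 := bracket_neq0.
(* The symmetries [swap] of the edge conditions, and below them the matching sign changes [cswap],
   bring a shared vertex to a standard place. *)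
have swap1 x y z t p q : nonconcurrent_edges x y z t p q -> nonconcurrent_edges y x z t p q.
  by rewrite /nonconcurrent_edges (setUC [set x]) (eq_sym x).
have swap2 x y z t p q : nonconcurrent_edges x y z t p q -> nonconcurrent_edges x y t z p q.
  by rewrite /nonconcurrent_edges (setUC [set z]) (eq_sym z).
have swap3 x y z t p q : nonconcurrent_edges x y z t p q -> nonconcurrent_edges x y z t q p.
  by rewrite /nonconcurrent_edges (setUC [set p]) (eq_sym p).
have swap12 x y z t p q : nonconcurrent_edges x y z t p q -> nonconcurrent_edges z t x y p q.
  rewrite /nonconcurrent_edges (setIC [set x; y]).
  by case=> [[? ? ?] [? ? ?] ?]; split=> //; split; rewrite // eq_sym.
have cswap1 x y z t p q : concurrency U y x z t p q = - concurrency U x y z t p q.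
  by rewrite /concurrency /bracket /det3; ring.
have cswap2 x y z t p q : concurrency U x y t z p q = - concurrency U x y z t p q.
  by rewrite /concurrency /bracket /det3; ring.
have cswap3 x y z t p q : concurrency U x y z t q p = - concurrency U x y z t p q.
  by rewrite /concurrency /bracket /det3; ring.
have cswap12 x y z t p q : concurrency U z t x y p q = - concurrency U x y z t p q.
  by rewrite /concurrency /bracket /det3; ring.
have noP x y z t p q w : nonconcurrent_edges x y z t p q ->
    [&& w \in [set x; y], w \in [set z; t] & w \in [set p; q]] = false.
  by case=> _ _ /setP/(_ w); rewrite !inE -andbA.
have share12 x y t p q : nonconcurrent_edges x y x t p q -> concurrency U x y x t p q != 0.
  move=> H; have := noP _ _ _ _ _ _ x H; rewrite !inE eqxx /= => /norP[xp xq].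
  case: H => [[xy xt pq] [xyxt _ _] _].
  have yt : y != t by apply: contraNneq xyxt => ->.
  have -> : concurrency U x y x t p q = bracket U x y t * bracket U x p q.
    by rewrite /concurrency /bracket /det3; ring.
  by rewrite mulf_neq0 ?b0.
have share13 x y z t q : nonconcurrent_edges x y z t x q -> concurrency U x y z t x q != 0.
  move=> H; have := noP _ _ _ _ _ _ x H; rewrite !inE eqxx /= andbT => /norP[xz xt].
  case: H => [[xy zt xq] [_ xyxq _] _].
  have yq : y != q by apply: contraNneq xyxq => ->.
  have -> : concurrency U x y z t x q = - (bracket U x y q * bracket U z t x).
    by rewrite /concurrency /bracket /det3; ring.
  by rewrite oppr_eq0 mulf_neq0 ?b0 // eq_sym.
have share123 x y z t p q : p \in [set x; y] -> nonconcurrent_edges x y z t p q ->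
    concurrency U x y z t p q != 0.
  rewrite !inE => /orP[]/eqP->; first exact: share13.
  by move/swap1/share13; rewrite cswap1 oppr_eq0.
have share1234 x y z t p q : p \in [set x; y] :|: [set z; t] ->
    nonconcurrent_edges x y z t p q -> concurrency U x y z t p q != 0.
  rewrite inE => /orP[]; first exact: share123.
  by move=> pzt /swap12 /(share123 _ _ _ _ _ _ pzt); rewrite cswap12 oppr_eq0.
move=> H.
have [eabcd|] := boolP (e \in [set a; b] :|: [set c; d]); first exact: share1234.
have [fabcd|] := boolP (f \in [set a; b] :|: [set c; d]).
  by move/swap3: H => /(share1234 _ _ _ _ _ _ fabcd); rewrite cswap3 oppr_eq0.
have [ac|ac] := eqVneq a c; first by move: H; rewrite -ac => /share12.
have [ad|ad] := eqVneq a d.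
  by move/swap2: H; rewrite cswap2 oppr_eq0 -ad => /share12.
have [bc|bc] := eqVneq b c.
  by move/swap1: H; rewrite cswap1 oppr_eq0 -bc => /share12.
have [bd|bd] := eqVneq b d.
  by move/swap2/swap1: H; rewrite cswap1 cswap2 opprK -bd => /share12.
case: H => [[ab cd ef] _ _].
rewrite !inE !negb_or -!andbA => /and4P[fa fb fc fd] /and4P[ea eb ec ed].
apply: gU.2; rewrite /= !inE !negb_or ab ac ad bc bd cd ef 2!(eq_sym a) 2!(eq_sym b).
by rewrite 2!(eq_sym c) 2!(eq_sym d) fa fb fc fd ea eb ec ed.
Qed.

(** After enlarging the support to three indices, which [m] being at least 3 allows, taking the
    determinant of the relation with two of the vectors isolates the coefficient of the third. *)
Lemma dependency_small_support (B : {set 'I_m}) (c : 'I_m -> K) :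
  (2 < m)%N -> (#|B| <= 3)%N -> (forall i, i \notin B -> c i = 0) ->
  (forall t, \sum_i c i * U i t = 0) -> forall i, c i = 0.
Proof.
move=> m3 B3 suppB c0.
have [B' sBB' B'3] : exists2 B' : {set 'I_m}, B \subset B' & #|B'| = 3.
  have [k] := ubnP (3 - #|B|)%N; elim: k B B3 {suppB} => // k IH B B3 lt.
  have [|lt3] := leqP 3 #|B|; first by exists B => //; apply/eqP; rewrite eqn_leq B3.
  have /subsetPn[x _ xB] : ~~ ([set: 'I_m] \subset B).
    by apply/negP => /subset_leq_card; rewrite cardsT card_ord leqNgt (leq_trans lt3).
  have cxB : #|x |: B| = #|B|.+1 by rewrite cardsU1 xB.
  have [||B' sB' B'3] := IH (x |: B); rewrite ?cxB //; first by lia.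
  by exists B' => //; apply: subset_trans sB'; apply: subsetUr.
move=> i; have [iB|] := boolP (i \in B'); last first.
  by move=> niB'; apply: suppB; apply: contra niB' => /(subsetP sBB').
have /cards2P[x [y [xy eB]]] : #|B' :\ i| == 2 by move: (cardsD1 i B'); rewrite iB B'3 add1n => -[<-].
have [ix iy] : i != x /\ i != y.
  by split; apply/negP => /eqP ei; have := setD11 i B'; rewrite eB !inE ei eqxx ?orbT.
have : \sum_k c k * det3 (U x) (U y) (U k) = 0.
  rewrite -bracket_sumr /det3 !c0; ring.
rewrite (bigD1 i) //= big1 ?addr0 => [|k ki].
  move/eqP; rewrite mulf_eq0 => /orP[/eqP//|]; rewrite -/(bracket U x y i).
  by rewrite (negbTE (bracket_neq0 _ _ _)) // eq_sym.
have [|kB] := boolP (k \in B'); last first.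
  by rewrite suppB ?mul0r //; apply: contra kB => /(subsetP sBB').
move=> kB; have : k \in B' :\ i by rewrite !inE ki.
rewrite eB !inE => /orP[]/eqP->; rewrite /det3; ring.
Qed.
End GeneralPosition.

(** * Generic vectors are in general position *)

Section Generic.
Variables (K : fieldType) (m n r : nat) (U : 'M[K]_(m, 3)) (V : 'M[K]_(n, r)).
Hypothesis gUV : generic_vectors U V.

Lemma prime_coefs_bracket i j k : prime_coefs (bracket (mpoly_U K m n 3 r) i j k).
Proof.
rewrite /bracket /det3.
have pX x t : prime_coefs (mpoly_U K m n 3 r x t) by rewrite mxE; apply: prime_coefsX.
have pM x y z t p q : prime_coefs (mpoly_U K m n 3 r x y * (mpoly_U K m n 3 r z t * mpoly_U K m n 3 r p q
    - mpoly_U K m n 3 r z q * mpoly_U K m n 3 r p t)).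
  by apply: prime_coefsM => //; apply: prime_coefsB; apply: prime_coefsM.
by apply: prime_coefsD => //; apply: prime_coefsB.
Qed.

Lemma eval_bracket (U' : 'M[K]_(m, 3)) (V' : 'M[K]_(n, r)) i j k :
  eval_at U' V' (bracket (mpoly_U K m n 3 r) i j k) = bracket U' i j k.
Proof.
have E x t : eval_at U' V' (mpoly_U K m n 3 r x t) = U' x t.
  by rewrite -[in RHS](eval_at_U U' V') [in RHS]mxE.
by rewrite /bracket /det3 eval_atD eval_atB !eval_atM !eval_atB !eval_atM !E.
Qed.

Lemma generic_general_position : general_position U.
Proof.
split=> [i j k|a b c d e f].
  rewrite /= !inE negb_or => /and3P[/andP[ij ik] jk _].
  pose U' : 'M[K]_(m, 3) := \matrix_(x, t)
     (if x == i then t == o0 else if x == j then t == o1 else t == o2)%:R.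
  rewrite -(eval_bracket U V); apply: (generic_eval_neq0 gUV (U' := U') (V' := V)).
    exact: prime_coefs_bracket.
  have Ui t : U' i t = (t == o0)%:R by rewrite mxE eqxx.
  have Uj t : U' j t = (t == o1)%:R by rewrite mxE eq_sym (negbTE ij) eqxx.
  have Uk t : U' k t = (t == o2)%:R.
    by rewrite mxE eq_sym (negbTE ik) eq_sym (negbTE jk).
  rewrite eval_bracket /bracket /det3 !Ui !Uj !Uk /=.
  by rewrite !(mulr0, mul0r, mulr1, subr0, addr0) oner_eq0.
rewrite /= !inE !negb_or => /and5P[].
move=> /and5P[ab ac ad ae af] /and4P[bc bd be bf] /and3P[cd ce cf] /andP[de df] /andP[ef _].
(* The three lines become the sides of the coordinate triangle, which are not concurrent: the first
   product of brackets is 1 and the second is 0. *)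
pose U' : 'M[K]_(m, 3) := \matrix_(x, t)
   (if x \in [:: a; f] then t == o0 else if x \in [:: b; c] then t == o1
    else t == o2)%:R.
pose P := concurrency (mpoly_U K m n 3 r) a b c d e f.
have evalP U1 : eval_at U1 V P = concurrency U1 a b c d e f.
  by rewrite eval_atB; congr (_ - _); rewrite eval_atM; congr (_ * _); exact: eval_bracket.
rewrite -evalP; apply: (generic_eval_neq0 gUV (U' := U') (V' := V)).
  by apply: prime_coefsB; apply: prime_coefsM; apply: prime_coefs_bracket.
have Ua t : U' a t = (t == o0)%:R by rewrite mxE !inE eqxx.
have Uf t : U' f t = (t == o0)%:R by rewrite mxE !inE eqxx orbT.
have Ub t : U' b t = (t == o1)%:R.
  by rewrite mxE !inE eq_sym (negbTE ab) (negbTE bf) eqxx.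
have Uc t : U' c t = (t == o1)%:R.
  by rewrite mxE !inE eq_sym (negbTE ac) (negbTE cf) eqxx orbT.
have Ud t : U' d t = (t == o2)%:R.
  by rewrite mxE !inE (eq_sym d a) (eq_sym d b) (eq_sym d c) (negbTE ad) (negbTE bd) (negbTE cd) (negbTE df).
have Ue t : U' e t = (t == o2)%:R.
  by rewrite mxE !inE (eq_sym e a) (eq_sym e b) (eq_sym e c) (negbTE ae) (negbTE be) (negbTE ce) (negbTE ef).
rewrite evalP /concurrency /bracket /det3 !Ua !Ub !Uc !Ud !Ue !Uf /=.
by rewrite !(mulr0, mul0r, mulr1, mul1r, subr0, sub0r, addr0, add0r, oppr0) ?oppr_eq0 ?oner_eq0.
Qed.
End Generic.

(** * Necessity *)

Lemma card_setDU (T : finType) (X Y : {set T}) : (#|X :\: Y| + #|Y| = #|X :|: Y|)%N.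
Proof. by rewrite cardsU cardsD; have := subset_leq_card (subsetIl X Y); lia. Qed.

(** * Counting the cells of [E] by columns *)

Section Columns.
Variables (m n : nat) (A : 'I_m -> {set 'I_n}).

Definition column (j : 'I_n) : {set 'I_m} := [set i | j \in A i].

Lemma mem_union_rows i j : ((i, j) \in union_rows A) = (j \in A i).
Proof.
apply/bigcupP/idP => [[k _]|ji]; last by exists i => //; rewrite !inE eqxx.
by rewrite !inE /= => /andP[/eqP ->].
Qed.

Lemma mem_in_exactly k j : (j \in in_exactly A k) = (#|column j| == k).
Proof. by rewrite inE. Qed.

Lemma column_le3P :
  (forall i j k l, uniq [:: i; j; k; l] -> #|A i :&: A j :&: A k :&: A l| = 0%N) <->
  (forall j, #|column j| <= 3)%N.
Proof.
split=> [A4 j|le3 i j k l u].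
  rewrite leqNgt; apply/negP => gt3.
  have := enum_uniq (column j).
  have memE x : x \in enum (column j) -> j \in A x by rewrite mem_enum inE.
  move: gt3 memE; rewrite cardE; case: (enum _) => [|a [|b [|c [|d s]]]] //= _ memE u.
  have abcd : uniq [:: a; b; c; d].
    by have := @subseq_uniq _ [:: a; b; c; d] [:: a, b, c, d & s]; apply=> //=; rewrite !eqxx sub0seq.
  have /eqP := A4 _ _ _ _ abcd; rewrite cards_eq0 => /eqP/setP/(_ j).
  by rewrite !inE !memE ?inE ?eqxx ?orbT.
apply/eqP; rewrite cards_eq0; apply/set0Pn => [[x]]; rewrite !inE -!andbA.
move=> /and4P[xi xj xk xl]; have := le3 x; rewrite leqNgt => /negP[].
have <- : #|[set:: [:: i; j; k; l]]| = 4%N by rewrite cardsE; apply/card_uniqP.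
apply: subset_leq_card; apply/subsetP => y; rewrite !inE.
by move=> /or4P[] /eqP->.
Qed.

Lemma card_union_rows : #|union_rows A| = (\sum_j #|column j|)%N.
Proof.
rewrite -sum1_card (eq_bigl (fun ij => ij.2 \in A ij.1)); last first.
  by case=> i j; rewrite mem_union_rows.
rewrite -(pair_big_dep xpredT (fun i j => j \in A i) (fun=> fun=> 1%N)) /=.
rewrite (exchange_big_dep xpredT) //=; apply: eq_bigr => j _.
by rewrite -sum1_card; apply: eq_bigl => i; rewrite inE.
Qed.

Lemma sum_card_column : (forall j, #|column j| <= 3)%N ->
  (\sum_j #|column j| = #|in_exactly A 1| + 2 * #|in_exactly A 2| + 3 * #|in_exactly A 3|)%N.
Proof.
move=> le3.
have cardE k : #|in_exactly A k| = (\sum_j (#|column j| == k))%N.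
  by rewrite -sum1_card big_mkcond; apply: eq_bigr => j _; rewrite mem_in_exactly; case: eqP.
rewrite !cardE !big_distrr -!big_split /=; apply: eq_bigr => j _.
by have := le3 j; case: #|column j| => [|[|[|[|]]]].
Qed.
End Columns.

Section Necessity.
Variables (K : fieldType) (m n r : nat) (U : 'M[K]_(m, 3)) (V : 'M[K]_(n, r)).
Variable A : 'I_m -> {set 'I_n}.
Hypothesis (hm : (2 < m)%N) (gU : general_position U).
Hypothesis indep : tensor_indep U V (union_rows A).

(* [tau t] is a column and [C t] the coordinates of a vector of its span which
   lies in the span of the [d] vectors [W]; such vectors tensored with the
   [v_(tau t)] live in a space of dimension [d * r]. *)
Lemma subspace_bound (T : finType) (P : {set T}) (d : nat) (W : 'I_d -> 'I_3 -> K)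
    (z : T -> 'I_d -> K) (tau : T -> 'I_n) (C : T -> 'I_m -> K) :
  (forall t i, t \in P -> tau t \notin A i -> C t i = 0) ->
  (forall t a, t \in P -> \sum_i C t i * U i a = \sum_e z t e * W e a) ->
  (forall l : T -> K, (forall t, t \notin P -> l t = 0) ->
     (forall j i, \sum_(t in P | tau t == j) l t * C t i = 0) -> forall t, l t = 0) ->
  (#|P| <= d * r)%N.
Proof.
move=> suppC CW free; rewrite leqNgt; apply/negP => lt.
pose M : 'M[K]_(#|P|, d * r) := \matrix_(t, x)
  (z (enum_val t) (mxtens_unindex x).1 * V (tau (enum_val t)) (mxtens_unindex x).2).
(* There are more vectors than the dimension [d * r], so a nontrivial relation exists among them. *)
have : kermx M != 0.
  rewrite kermx_eq0 /row_free neq_ltn (leq_ltn_trans _ lt) //.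
  exact: rank_leq_col.
case/rowV0Pn => c /sub_kermxP cM c0.
pose l t := \sum_(e | enum_val e == t) c 0 e.
have lE e : l (enum_val e) = c 0 e.
  by rewrite /l (big_pred1 e) // => e'; rewrite /= (inj_eq enum_val_inj).
have l0 t : t \notin P -> l t = 0.
  move=> tP; rewrite /l big_pred0 // => e; apply/negbTE; apply: contra tP => /eqP <-.
  exact: enum_valP.
clearbody l.
have lM e b : \sum_(t in P) l t * (z t e * V (tau t) b) = 0.
  move/rowP: cM => /(_ (mxtens_index (e, b))); rewrite [LHS]mxE [RHS]mxE.
  rewrite [in X in _ -> X]big_enum_val; apply: etrans; apply: eq_bigr => t _.
  by rewrite lE mxE mxtens_indexK.
case/negP: c0; apply/eqP/rowP => e; rewrite mxE -lE; apply: free => // j i.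
(* Expanding that relation in the vectors of [E], [D i j] is the coefficient at [(i, j)];
   independence makes it vanish, and then [free] makes [l] vanish. *)
pose D i j := \sum_(t in P | tau t == j) l t * C t i.
move: (tensor_indepP U V (union_rows A)) => [/(_ indep) ind _].
apply: (ind D) => {i j} [i j|a b].
  rewrite mem_union_rows => nA; apply: big1 => t /andP[tP /eqP tj].
  by rewrite suppC ?mulr0 // tj.
have -> : \sum_i \sum_j D i j * (U i a * V j b) =
    \sum_(t in P) l t * ((\sum_i C t i * U i a) * V (tau t) b).
  under eq_bigr => i _ do under eq_bigr => j _ do rewrite big_distrl /=.
  under eq_bigr => i _.
    rewrite (exchange_big_dep (mem P)) /=; last by move=> j t _ /andP[].
    under eq_bigr => t tP.
      rewrite tP /= (big_pred1 (tau t)); last by move=> j; rewrite /= eq_sym.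
      over.
    over.
  rewrite exchange_big; apply: eq_bigr => t tP /=.
  by rewrite mulr_suml mulr_sumr; apply: eq_bigr => i _; ring.
transitivity (\sum_e W e a * \sum_(t in P) l t * (z t e * V (tau t) b)).
  under [in RHS]eq_bigr => e' _ do rewrite mulr_sumr.
  rewrite [RHS]exchange_big; apply: eq_bigr => t tP /=.
  rewrite CW // mulr_suml mulr_sumr; apply: eq_bigr => e' _; ring.
by apply: big1 => e' _; rewrite lM mulr0.
Qed.

(** The case of a line: the tensors of [x] with [v_j], for [j] in [S], are independent and lie in a
    space of dimension [r]. *)
Lemma point_bound (x : 'I_3 -> K) (S : {set 'I_n}) :
  ~ (forall a, x a = 0) ->
  (forall j, j \in S -> exists2 C : 'I_m -> K, forall i, j \notin A i -> C i = 0 &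
     forall a, \sum_i C i * U i a = x a) ->
  (#|S| <= r)%N.
Proof.
move=> x0 CS; rewrite -[r]mul1n.
have /fin_all_exists[C CP] : forall j, exists C : 'I_m -> K, j \in S ->
    (forall i, j \notin A i -> C i = 0) /\ (forall a, \sum_i C i * U i a = x a).
  move=> j; have [/CS[C C1 C2]|jS] := boolP (j \in S); first by exists C.
  by exists (fun=> 0).
apply: (@subspace_bound _ S 1 (fun=> x) (fun=> fun=> 1) id C).
- by move=> t i tS; apply: (CP t tS).1.
- by move=> t a tS; rewrite (CP t tS).2 big_ord1 mul1r.
move=> l lS l0 t; have [tS|/lS //] := boolP (t \in S).
apply/eqP; apply: contraT => lt; case: x0 => a; rewrite -(CP t tS).2.
apply: big1 => i _; have := l0 t i; rewrite (big_pred1 t) => [|j].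
  by move/eqP; rewrite mulf_eq0 (negbTE lt) => /eqP->; rewrite mul0r.
by rewrite /= andbC; case: eqP => // ->.
Qed.

(** Cramer's rule in the basis formed by three of the [u_i]. *)
Lemma column_span (B : {set 'I_m}) (x : 'I_3 -> K) : #|B| = 3 ->
  exists2 C : 'I_m -> K, forall i, i \notin B -> C i = 0 &
    forall a, \sum_i C i * U i a = x a.
Proof.
move=> B3.
have [a [b [c [ab ac bc eB]]]] : exists a b c, [/\ a != b, a != c, b != c & B = [set a; b; c]].
  have /card_gt0P[a aB] : (0 < #|B|)%N by rewrite B3.
  have /cards2P[b [c [bc eB]]] : #|B :\ a| == 2.
    by move: (cardsD1 a B); rewrite aB B3 add1n => -[<-].
  have [ab ac] : a != b /\ a != c.
    by split; apply/negP => /eqP ei; have := setD11 a B; rewrite eB !inE ei eqxx ?orbT.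
  by exists a, b, c; split=> //; rewrite -(setD1K aB) eB setUA.
pose y := bracket U a b c.
have y0 : y != 0 by apply: bracket_neq0.
exists (fun i => if i == a then det3 x (U b) (U c) / y else
   if i == b then - det3 x (U a) (U c) / y else
   if i == c then det3 x (U a) (U b) / y else 0).
  by move=> i; rewrite eB !inE !negb_or -!andbA => /and3P[/negbTE-> /negbTE-> /negbTE->].
move=> t; rewrite (bigD1 a) //= (bigD1 b) //=; last by rewrite eq_sym.
rewrite (bigD1 c) /=; last by rewrite eq_sym ac eq_sym bc.
rewrite big1 => [|i /andP[/andP[/negbTE-> /negbTE->] /negbTE->]]; last by rewrite mul0r.
rewrite !eqxx ![_ == a]eq_sym (negbTE ab) (negbTE ac) [c == b]eq_sym (negbTE bc) addr0.
apply: (mulfI y0); rewrite !mulrDr !mulrA ![y * _ / y]mulrC !mulKf //.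
have := det3_cramer x (U a) (U b) (U c) t; rewrite -/(bracket U a b c) -/y.
move/eqP; rewrite -!addrA addr_eq0 => /eqP ->; ring.
Qed.

Lemma sum_delta (x : K) (i : 'I_m) (f : 'I_m -> K) :
  \sum_k x * (k == i)%:R * f k = x * f i.
Proof.
rewrite (bigD1 i) //= eqxx mulr1 big1 ?addr0 // => k /negbTE->.
by rewrite mulr0 mul0r.
Qed.

Lemma indep_column_le3 j : (#|column A j| <= 3)%N.
Proof.
move: j; apply/column_le3P => i j k l; rewrite /= !inE !negb_or !andbT.
move=> /and3P[/and3P[ij ik il] /andP[jk jl] kl]; apply/eqP; rewrite cards_eq0.
apply/set0Pn => [[x]]; rewrite !inE -!andbA => /and4P[xi xj xk xl].
(* The coefficients of the relation between four vectors; the one at [i] is a nonzero bracket. *)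
pose c t := bracket U j k l * (t == i)%:R - bracket U i k l * (t == j)%:R
  + bracket U i j l * (t == k)%:R - bracket U i j k * (t == l)%:R.
pose C t y := if y == x then c t else 0.
move: (tensor_indepP U V (union_rows A)) => [/(_ indep) ind _].
have /eqP : C i x = 0.
  apply: (ind C) => [t y|a b].
    rewrite mem_union_rows /C; case: eqP => // -> nt.
    have ne z : x \in A z -> t == z = false by move=> xz; apply: contraNF nt => /eqP->.
    by rewrite /c !ne // !mulr0 !subr0 addr0.
  transitivity ((\sum_t c t * U t a) * V x b).
    rewrite big_distrl /=; apply: eq_bigr => t _; rewrite (bigD1 x) //= big1.
      by rewrite /C eqxx addr0 mulrA.
    by move=> y /negbTE yx; rewrite /C yx mul0r.
  under eq_bigr => t _ do rewrite /c !mulrBl mulrDl mulrBl.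
  rewrite !sumrB big_split /= sumrB !sum_delta bracket_plucker mul0r //.
rewrite /C eqxx /c eqxx (negbTE ij) (negbTE ik) (negbTE il) mulr1 !mulr0 !subr0 addr0.
exact/negP/bracket_neq0.
Qed.

Lemma row_neq0 i : ~ (forall a, U i a = 0).
Proof.
move=> Ui0.
have [j [k [ij ik jk]]] : exists j k, [/\ i != j, i != k & j != k].
  have : (1 < #|[set~ i]|)%N by rewrite cardsC1 card_ord; lia.
  case/card_gt1P => j [k [ji ki jk]]; exists j, k.
  by move: ji ki; rewrite !inE ![i == _]eq_sym => -> ->.
have := bracket_neq0 gU ij ik jk.
by rewrite /bracket /det3 !Ui0 !mul0r subr0 addr0 eqxx.
Qed.

Lemma delta_span i j : j \in A i -> exists2 C : 'I_m -> K,
  forall k, j \notin A k -> C k = 0 & forall a, \sum_k C k * U k a = U i a.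
Proof.
move=> ji; exists (fun k => 1 * (k == i)%:R).
  by move=> k jk; rewrite (_ : k == i = false) ?mulr0 //; apply: contraNF jk => /eqP->.
by move=> a; rewrite sum_delta mul1r.
Qed.

Lemma exactly3_span j (x : 'I_3 -> K) : j \in in_exactly A 3 -> exists2 C : 'I_m -> K,
  forall k, j \notin A k -> C k = 0 & forall a, \sum_k C k * U k a = x a.
Proof.
rewrite mem_in_exactly => /eqP /(column_span x)[C C1 C2]; exists C => // k jk.
by rewrite C1 // inE.
Qed.

Lemma indep_row_bound i : (#|A i :\: in_exactly A 3| + #|in_exactly A 3| <= r)%N.
Proof.
rewrite card_setDU; apply: (point_bound (@row_neq0 i)) => j; rewrite inE.
by case/orP; [apply: delta_span | apply: exactly3_span].
Qed.

Lemma pair_span i j k : j != k -> i \in A j -> i \in A k -> forall x y : K, exists2 C : 'I_m -> K,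
  forall t, i \notin A t -> C t = 0 &
  forall a, \sum_t C t * U t a = x * U j a + y * U k a.
Proof.
move=> jk ij ik x y; exists (fun t => x * (t == j)%:R + y * (t == k)%:R) => [t it|a].
  have ne z : i \in A z -> t == z = false by move=> iz; apply: contraNF it => /eqP->.
  by rewrite !ne // !mulr0 addr0.
by under eq_bigr => t _ do rewrite mulrDl; rewrite big_split /= !sum_delta.
Qed.

Lemma pair_free i j : i != j -> forall x y : K,
  (forall a, x * U i a + y * U j a = 0) -> x = 0 /\ y = 0.
Proof.
move=> ij x y xy0.
pose c k := x * (k == i)%:R + y * (k == j)%:R.
have c0 : forall k, c k = 0.
  apply: (@dependency_small_support K m U gU [set i; j]) => //.
  - by rewrite cards2 ij.
  - by move=> k; rewrite !inE negb_or /c => /andP[/negbTE-> /negbTE->]; rewrite !mulr0 addr0.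
  - move=> a; under eq_bigr => k _ do rewrite mulrDl.
    by rewrite big_split /= !sum_delta xy0.
move: (c0 i) (c0 j); rewrite /c !eqxx [j == i]eq_sym (negbTE ij).
by rewrite !mulr1 !mulr0 addr0 add0r.
Qed.

Lemma indep_crossing_bound i j k l : uniq [:: i; j; k; l] ->
  (#|(A i :&: A j) :\: in_exactly A 3| + #|(A k :&: A l) :\: in_exactly A 3|
     + #|in_exactly A 3| <= r)%N.
Proof.
move=> u; have /column_le3P /(_ _ _ _ _ u) := indep_column_le3.
move/eqP; rewrite -setIA cards_eq0 => /eqP dis.
move: u; rewrite /= !inE !negb_or !andbT => /and3P[/and3P[ij ik il] /andP[jk jl] kl].
(* No column lies in all four sets, so the two intersections are disjoint and the sum is the size of
   one union. *)
rewrite -addnA card_setDU (_ : (_ + _)%N = #|A i :&: A j :|: (A k :&: A l :|: in_exactly A 3)|); last first.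
  rewrite -(card_setDU (A i :&: A j)); congr (_ + _)%N; apply: eq_card => t.
  rewrite !in_setD [in RHS]in_setU negb_or ![_ && (t \in A i :&: A j)]andbC.
  have [tX|//] := boolP (t \in A i :&: A j).
  by move/setP: dis => /(_ t); rewrite inE tX in_set0 /= => ->.
(* The meeting point of the lines [ij] and [kl]: by [bracket_plucker] it is a combination of [u_i]
   and [u_j], and also one of [u_k] and [u_l]. *)
apply: (@point_bound (fun a => bracket U j k l * U i a - bracket U i k l * U j a)) => [x0|t].
  have [] := @pair_free i j ij (bracket U j k l) (- bracket U i k l).
    by move=> a; rewrite mulNr x0.
  by move=> /eqP + _; apply/negP/bracket_neq0.
rewrite inE => /orP[|]; last (rewrite inE => /orP[|]; last exact: exactly3_span).
  rewrite inE => /andP[ti tj].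
  have [C C1 C2] := pair_span ij ti tj (bracket U j k l) (- bracket U i k l).
  by exists C => // a; rewrite C2 mulNr.
rewrite inE => /andP[tk tl].
have [C C1 C2] := pair_span kl tk tl (- bracket U i j l) (bracket U i j k).
exists C => // a; rewrite C2.
have /eqP := bracket_plucker U i j k l a; rewrite -addrA addr_eq0 => /eqP ->; ring.
Qed.

Lemma indep_total_bound :
  (#|in_exactly A 1| + 2 * #|in_exactly A 2| + 3 * #|in_exactly A 3| <= 3 * r)%N.
Proof.
rewrite -sum_card_column; last exact: indep_column_le3.
rewrite -card_union_rows.
apply: (@subspace_bound _ _ 3 (fun e a => (e == a)%:R) (fun t e => U t.1 e) snd
  (fun t k => 1 * (k == t.1)%:R)).
- move=> [i j] k; rewrite mem_union_rows /= => ji jk.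
  by rewrite (_ : k == i = false) ?mulr0 //; apply: contraNF jk => /eqP->.
- move=> [i j] a _ /=; rewrite sum_delta mul1r (bigD1 a) //= eqxx mulr1 big1 ?addr0 //.
  by move=> e /negbTE->; rewrite mulr0.
move=> l lE l0 [i j]; have [ijE|/lE //] := boolP ((i, j) \in union_rows A).
apply: etrans (l0 j i); rewrite (bigD1 (i, j)) /=; last by rewrite ijE eqxx.
rewrite eqxx !mulr1 big1 ?addr0 // => -[i' j'] /andP[/andP[_ /= /eqP->]].
by rewrite xpair_eqE eqxx andbT [i == _]eq_sym => /negbTE->; rewrite !mulr0.
Qed.

Lemma card_fibers (T T' : finType) (F : T' -> {set T}) :
  #|[set t : T * T' | t.1 \in F t.2]| = (\sum_e #|F e|)%N.
Proof.
rewrite -sum1_card (eq_bigl (fun t : T * T' => t.1 \in F t.2)); last by move=> t; rewrite inE.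
rewrite -(pair_big_dep xpredT (fun x e => x \in F e) (fun=> fun=> 1%N)) /=.
rewrite (exchange_big_dep xpredT) //=; apply: eq_bigr => e _.
by rewrite sum1_card.
Qed.

(** For each column, tagged vectors in the plane of [u_i] and [u_j] are listed: tag [o0] for [u_i],
    [o1] for [u_j], and [o2] for the point where the line of a two-element column avoiding both
    crosses the line [ij]. Their number is the left side, and [subspace_bound] applies with
    [d = 2]. *)
Lemma indep_line_bound i j : i != j ->
  (#|A i :\: in_exactly A 3| + #|A j :\: in_exactly A 3|
    + #|in_exactly A 2 :\: (in_exactly A 3 :|: A i :|: A j)|
    + 2 * #|in_exactly A 3| <= 2 * r)%N.
Proof.
move=> ij; set S3 := in_exactly A 3; set S2 := in_exactly A 2.
pose F (e : 'I_3) := if e == o0 then A i :|: S3 else if e == o1 then A j :|: S3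
  else S2 :\: (S3 :|: A i :|: A j).
have -> : (#|A i :\: S3| + #|A j :\: S3| + #|S2 :\: (S3 :|: A i :|: A j)| + 2 * #|S3|
    = #|[set t : 'I_n * 'I_3 | t.1 \in F t.2]|)%N.
  rewrite card_fibers !big_ord_recl big_ord0 /F /= -!card_setDU. ring.
set P := [set _ | _].
(* [Cz t] holds the coefficients of the vector within its column, then its coordinates along [u_i]
   and [u_j]. *)
have /fin_all_exists[Cz CzP] : forall t : 'I_n * 'I_3, exists Cz : ('I_m -> K) * (K * K), t \in P ->
    [/\ forall k, t.1 \notin A k -> Cz.1 k = 0,
        forall a, \sum_k Cz.1 k * U k a = Cz.2.1 * U i a + Cz.2.2 * U j a &
        [/\ t.2 = o0 -> Cz.2 = (1, 0), t.2 = o1 -> Cz.2 = (0, 1) &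
            t.2 = o2 -> Cz.2.1 != 0]].
  case=> x e; have [|] := boolP ((x, e) \in P); last by exists (fun=> 0, (0, 0)).
  rewrite inE /=; elim/ord3_ind: e; rewrite /F /=.
  - move=> H; have [C C1 C2] : exists2 C : 'I_m -> K,
       forall k, x \notin A k -> C k = 0 & forall a, \sum_k C k * U k a = U i a.
      by move: H; rewrite in_setU => /orP[|]; [apply: delta_span | apply: exactly3_span].
    by exists (C, (1, 0)) => _; split=> // a /=; rewrite C2 ?mul1r ?mul0r ?addr0.
  - move=> H; have [C C1 C2] : exists2 C : 'I_m -> K,
       forall k, x \notin A k -> C k = 0 & forall a, \sum_k C k * U k a = U j a.
      by move: H; rewrite in_setU => /orP[|]; [apply: delta_span | apply: exactly3_span].
    by exists (C, (0, 1)) => _; split=> // a /=; rewrite C2 ?mul1r ?mul0r ?add0r.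
  rewrite !inE => /andP[/norP[/norP[_ xi] xj]] /cards2P[k [l [kl ekl]]].
  have xA y : (x \in A y) = (y \in [set k; l]) by rewrite -ekl inE.
  have xk : x \in A k by rewrite xA !inE eqxx.
  have xl : x \in A l by rewrite xA !inE eqxx orbT.
  move: xi xj; rewrite !xA !inE !negb_or => /andP[ik il] /andP[jk jl].
  have [C C1 C2] := pair_span kl xk xl (- bracket U i j l) (bracket U i j k).
  exists (C, (bracket U j k l, - bracket U i k l)) => _; split=> //.
    move=> a; rewrite C2 /= (mulNr (bracket U i k l)).
    have /eqP := bracket_plucker U i j k l a; rewrite -addrA addr_eq0 => /eqP ->; ring.
  by split=> // _; apply: bracket_neq0.
apply: (@subspace_bound _ P 2 (fun e => if e == ord0 then U i else U j)
  (fun t e => if e == ord0 then (Cz t).2.1 else (Cz t).2.2) fst (fun t => (Cz t).1)).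
- by move=> t k tP; have [H _ _] := CzP t tP; apply: H.
- by move=> t a tP; have [_ H _] := CzP t tP; rewrite H !big_ord_recl big_ord0 addr0.
move=> l lP l0 [x e]; have [tP|/lP //] := boolP ((x, e) \in P).
have sumE (f : 'I_n * 'I_3 -> K) : \sum_(t in P | t.1 == x) l t * f t =
    l (x, o0) * f (x, o0) + l (x, o1) * f (x, o1) + l (x, o2) * f (x, o2).
  rewrite big_mkcond /= (eq_bigr (fun t => (t.1 == x)%:R * (l t * f t))); last first.
    move=> t _; case: (boolP (t \in P)) => /= [_|/lP ->]; last by rewrite mul0r mulr0.
    by case: eqP => _; rewrite ?mul1r ?mul0r.
  transitivity (\sum_y \sum_e' (y == x)%:R * (l (y, e') * f (y, e'))).
    by rewrite pair_bigA; apply: eq_bigr => -[].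
  rewrite (bigD1 x) //= [X in _ + X]big1 ?addr0 => [|y /negbTE yx]; last first.
    by rewrite big1 // => e' _; rewrite yx mul0r.
  rewrite !big_ord_recl big_ord0 /= eqxx !mul1r addr0 addrA.
  by do ![congr (_ + _)]; congr (l (x, _) * f (x, _)); apply: val_inj.
have combo a : \sum_(t in P | t.1 == x) l t * ((Cz t).2.1 * U i a + (Cz t).2.2 * U j a) = 0.
  transitivity (\sum_k (\sum_(t in P | t.1 == x) l t * (Cz t).1 k) * U k a); last first.
    by apply: big1 => k _; rewrite l0 mul0r.
  under [RHS]eq_bigr => k _ do rewrite mulr_suml.
  rewrite [RHS]exchange_big; apply: eq_bigr => t /andP[tP' _] /=.
  have [_ <- _] := CzP t tP'; rewrite mulr_sumr; apply: eq_bigr => k _; ring.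
have [c1 c2] : \sum_(t in P | t.1 == x) l t * (Cz t).2.1 = 0 /\
    \sum_(t in P | t.1 == x) l t * (Cz t).2.2 = 0.
  apply: (pair_free ij) => a; apply: etrans (combo a).
  by rewrite !mulr_suml -big_split; apply: eq_bigr => t _ /=; ring.
rewrite !sumE in c1 c2.
have z0 : (x, o0) \in P -> (Cz (x, o0)).2 = (1, 0).
  by move=> tP'; have [_ _ [H _ _]] := CzP _ tP'; apply: H.
have z1 : (x, o1) \in P -> (Cz (x, o1)).2 = (0, 1).
  by move=> tP'; have [_ _ [_ H _]] := CzP _ tP'; apply: H.
have P0E : ((x, o0) \in P) = (x \in A i :|: S3) by rewrite inE.
have P1E : ((x, o1) \in P) = (x \in A j :|: S3) by rewrite inE.
have P2E : ((x, o2) \in P) = (x \in S2 :\: (S3 :|: A i :|: A j)) by rewrite inE.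
(* A column with tag [o2] has no other tag, so the two coordinate equations determine all the
   unknowns. *)
have [t2|t2] := boolP ((x, o2) \in P).
  have l00 : l (x, o0) = 0.
    by apply: lP; rewrite P0E; move: t2; rewrite P2E !inE => /andP[/norP[/norP[? ?] ?] _]; apply/norP.
  have l10 : l (x, o1) = 0.
    by apply: lP; rewrite P1E; move: t2; rewrite P2E !inE => /andP[/norP[/norP[? ?] ?] _]; apply/norP.
  have l20 : l (x, o2) = 0.
    move: c1; rewrite l00 l10 !mul0r !add0r => /eqP; rewrite mulf_eq0 => /orP[/eqP //|].
    by have [_ _ [_ _ /(_ erefl)/negbTE->]] := CzP _ t2.
  by move: {tP} e; elim/ord3_ind.
have l20 := lP _ t2.
have l00 : l (x, o0) = 0.
  have [tP0|/lP //] := boolP ((x, o0) \in P).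
  move: c1; rewrite l20 z0 // mulr1 mul0r addr0.
  have [/z1 ->|/lP ->] := boolP ((x, o1) \in P); by rewrite ?mulr0 ?mul0r addr0.
have l10 : l (x, o1) = 0.
  have [tP1|/lP //] := boolP ((x, o1) \in P).
  by move: c2; rewrite l20 l00 z1 // mulr1 !mul0r addr0 add0r.
by move: {tP} e; elim/ord3_ind.
Qed.
End Necessity.

(** * Sufficiency *)

(* [lia] compares atoms syntactically, which fails on cardinals carrying
   different but convertible [finType] instances. *)
Ltac card_lia :=
  repeat match goal with
  | H : is_true (leq _ _) |- _ => revert H
  | H : @eq nat _ _ |- _ => revert H
  end;
  repeat match goal with |- context [ #|?X| ] => move: #|X| => ? end;
  lia.

(** Independent rows give rank [#|P|], so with at most [#|P|] columns the matrix is square and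
    invertible. This turns the independent rows given by Rado's theorem into the trivial right
    kernel that the slots require. *)
Lemma square_dual (F : fieldType) (I X : finType) (P : {set I}) (Y : {set X})
    (M : I -> X -> F) :
  (#|Y| <= #|P|)%N ->
  (forall l : I -> F, (forall x, x \in Y -> \sum_(i in P) l i * M i x = 0) ->
     forall i, i \in P -> l i = 0) ->
  forall u : X -> F, (forall i, i \in P -> \sum_(x in Y) M i x * u x = 0) ->
  forall x, x \in Y -> u x = 0.
Proof.
move=> leYP inj u u0.
pose T : 'M[F]_(#|P|, #|Y|) := \matrix_(i, x) M (enum_val i) (enum_val x).
have Tfree : row_free T.
  rewrite -kermx_eq0; apply/rowV0P => c /sub_kermxP cT.
  pose l i := \sum_(e | enum_val e == i) c 0 e.
  have lE e : l (enum_val e) = c 0 e.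
    by rewrite /l (big_pred1 e) // => e'; rewrite /= (inj_eq enum_val_inj).
  apply/rowP => e; rewrite mxE -lE; apply: inj (enum_valP e) => x xY.
  move/rowP: cT => /(_ (enum_rank_in xY x)); rewrite [LHS]mxE [RHS]mxE.
  rewrite [in X in _ -> X]big_enum_val; apply: etrans; apply: eq_bigr => i _.
  by rewrite lE mxE enum_rankK_in.
have Tfull : row_full T.
  by rewrite /row_full eqn_leq rank_leq_col /=; move: Tfree; rewrite /row_free => /eqP->.
have [B BT] := row_fullP Tfull.
pose v : 'cV[F]_#|Y| := \col_x u (enum_val x).
have Tv : T *m v = 0.
  apply/colP => i; rewrite mxE [RHS]mxE -[RHS](u0 (enum_val i) (enum_valP i)).
  by rewrite [RHS]big_enum_val; apply: eq_bigr => x _; rewrite !mxE.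
have v0 : v = 0 by rewrite -[v]mul1mx -BT -mulmxA Tv mulmx0.
move=> x xY; move/colP: v0 => /(_ (enum_rank_in xY x)).
by rewrite !mxE enum_rankK_in.
Qed.

(** Applied to block ranks, with [X] among the blocks of rank at least 1 and [Y] among those of rank
    at least 2. *)
Lemma sum_ge_card2 (T : finType) (X Y : {set T}) (f : T -> nat) :
  (forall x, (x \in X) + (x \in Y) <= f x)%N -> (#|X| + #|Y| <= \sum_x f x)%N.
Proof.
move=> le; rewrite -!sum1_card [Z in (Z + _)%N]big_mkcond.
rewrite [Z in (_ + Z)%N]big_mkcond -big_split leq_sum //= => x _.
by apply: leq_trans (le x); do 2 case: (_ \in _).
Qed.

Lemma two_set_eq (T : finType) (X Y : {set T}) x y : #|X| = 2 -> #|Y| = 2 ->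
  x != y -> x \in X -> y \in X -> x \in Y -> y \in Y -> X = Y.
Proof.
move=> X2 Y2 xy xX yX xY yY.
have eq2 (Z : {set T}) : #|Z| = 2 -> x \in Z -> y \in Z -> Z = [set x; y].
  move=> Z2 xZ yZ; apply/esym/eqP; rewrite eqEcard subUset !sub1set xZ yZ /=.
  by rewrite Z2 cards2 xy.
by rewrite (eq2 X) // (eq2 Y).
Qed.

Lemma subset_of_card (T : finType) (X : {set T}) k : (k <= #|X|)%N ->
  exists2 Y : {set T}, Y \subset X & #|Y| = k.
Proof.
elim: k => [|k IH] lt; first by exists set0; rewrite ?sub0set ?cards0.
have [Y sYX Yk] := IH (ltnW lt).
have /subsetPn[x xX xY] : ~~ (X \subset Y).
  by apply/negP => /subset_leq_card; rewrite Yk leqNgt lt.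
by exists (x |: Y); rewrite ?cardsU1 ?xY ?Yk // subUset sub1set xX.
Qed.

Section Sufficiency.
Variables (K : fieldType) (m n : nat) (U : 'M[K]_(m, 3)).
Variable A : 'I_m -> {set 'I_n}.
Hypothesis (hm : (2 < m)%N) (gU : general_position U).
Hypothesis col_le3 : forall j, (#|column A j| <= 3)%N.
Let S1 := in_exactly A 1.
Let S2 := in_exactly A 2.
Let S3 := in_exactly A 3.
Variables (p q : 'I_n -> 'I_m).
Hypothesis col1 : forall j, j \in S1 -> column A j = [set p j].
Hypothesis col2 : forall j, j \in S2 -> p j != q j /\ column A j = [set p j; q j].

Lemma in_column i j : (i \in column A j) = (j \in A i).
Proof. by rewrite inE. Qed.

(* Columns of [H] and [S3] receive distinct basis vectors, and the extra columns
   vanish on the coordinates of [S3]; [c] lists the other coordinates of the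
   extra columns, the [D] unused basis vectors being indexed by [inr]. *)
Lemma slot_criterion (r : nat) (H : {set 'I_n}) (D : nat)
    (c : 'I_n + 'I_D -> 'I_n -> K) :
  H \subset S2 -> (#|S3| + #|H| + D = r)%N ->
  (forall C : 'I_m -> 'I_n -> K,
     (forall i j, j \notin A i -> C i j = 0) ->
     (forall i j, j \in S3 :|: H -> C i j = 0) ->
     (forall h, h \in H ->
        \sum_i \sum_j c (inl h) j * (C i j * bracket U (p h) (q h) i) = 0) ->
     (forall d a, \sum_i \sum_j c (inr d) j * (C i j * U i a) = 0) ->
     forall i j, C i j = 0) ->
  exists V : 'M[K]_(n, r), tensor_indep U V (union_rows A).
Proof.
move=> HS2 er red; pose R := S3 :|: H.
have {}er : (#|R| + D)%N = r.
  rewrite -er cardsU (_ : S3 :&: H = set0) ?cards0 ?subn0 //.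
  apply/setP => x; rewrite !inE; apply/negP => /andP[/eqP x3 /(subsetP HS2)].
  by rewrite inE x3.
subst r.
pose gam k j := if k \in S3 then 0 else c (inl k) j.
pose V : 'M[K]_(n, #|R| + D) := \matrix_(j, b) match split b with
  | inl x => if j \in R then (j == enum_val x)%:R else gam (enum_val x) j
  | inr d => if j \in R then 0 else c (inr d) j
  end.
exists V; apply/tensor_indepP => C suppC C0.
have {}suppC i j : j \notin A i -> C i j = 0.
  by move=> jA; apply: suppC; rewrite mem_union_rows.
pose C' i j := if j \in R then 0 else C i j.
have E1 k a : k \in R -> \sum_i (C i k + \sum_j gam k j * C' i j) * U i a = 0.
  move=> kR; apply: etrans (C0 a (lshift D (enum_rank_in kR k))).
  apply: eq_bigr => i _; rewrite mulrDl mulr_suml.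
  rewrite [RHS](bigD1 k) //= [X in _ + X = _](bigD1 k) //= /C' kR mulr0 mul0r add0r.
  rewrite mxE; case: splitP => [x /= /ord_inj <-|d /= ex]; last first.
    by have := ltn_ord (enum_rank_in kR k); rewrite ex ltnNge leq_addr.
  rewrite enum_rankK_in // kR eqxx mulr1; congr (_ + _); apply: eq_bigr => j jk.
  rewrite mxE; case: splitP => [y /= /ord_inj <-|d /= ex]; last first.
    by have := ltn_ord (enum_rank_in kR k); rewrite ex ltnNge leq_addr.
  rewrite enum_rankK_in // (negbTE jk); case: ifP => _; first by rewrite mulr0 mul0r !mulr0.
  ring.
have E2 d a : \sum_i \sum_j c (inr d) j * (C' i j * U i a) = 0.
  apply: etrans (C0 a (rshift #|R| d)); apply: eq_bigr => i _; apply: eq_bigr => j _.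
  rewrite mxE; case: splitP => [x /= ex|d' /= /addnI/ord_inj <-].
    by have := ltn_ord x; rewrite -ex ltnNge leq_addr.
  rewrite /C'; case: ifP => _; first by rewrite mul0r !mulr0.
  ring.
have C'0 : forall i j, C' i j = 0.
  apply: red => //.
  - by move=> i j jA; rewrite /C' suppC ?if_same.
  - by move=> i j jR; rewrite /C' jR.
  move=> h hH.
  have hR : h \in R by rewrite inE hH orbT.
  have [pq colh] := col2 (subsetP HS2 _ hH).
  have hS3 : h \in S3 = false.
    by have := subsetP HS2 _ hH; rewrite !inE => /eqP->.
  (* The form with kernel [L_h] removes the contribution of column [h] itself and leaves a condition
     on the extra columns. *)
  have : \sum_i (C i h + \sum_j gam h j * C' i j) * det3 (U (p h)) (U (q h)) (U i) = 0.
    by rewrite -bracket_sumr /det3 !E1 //; ring.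
  apply: etrans; apply: eq_bigr => i _; rewrite mulrDl -/(bracket U (p h) (q h) i).
  rewrite (_ : C i h * _ = 0) ?add0r; last first.
    have [|nhA] := boolP (h \in A i); last by rewrite suppC // mul0r.
    rewrite -in_column colh !inE => /orP[] /eqP->; rewrite /bracket /det3; ring.
  by rewrite mulr_suml; apply: eq_bigr => j _; rewrite /gam hS3 mulrA.
(* With the extra columns gone, [E1] is a relation between at most three vectors [u_i]. *)
move=> i j; have [jR|jR] := boolP (j \in R); last by have := C'0 i j; rewrite /C' (negbTE jR).
apply: (@dependency_small_support K m U gU (column A j) (C^~ j)) => //.
  by move=> k; rewrite in_column => /suppC.
move=> a; apply: etrans (E1 j a jR); apply: eq_bigr => k _.
by rewrite big1 ?addr0 // => y _; rewrite C'0 mulr0.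
Qed.

Lemma S12_disjoint j : j \in S1 -> j \in S2 = false.
Proof. by rewrite !inE => /eqP->. Qed.

(** A column meeting row [i] has one, two or three elements, so outside [S3] only [S1] and [S2]
    remain. *)
Lemma card_row (i : 'I_m) : (#|A i :\: S3| = #|A i :&: S1| + #|A i :&: S2|)%N.
Proof.
rewrite -cardsUI (_ : A i :&: S1 :&: (A i :&: S2) = set0) ?cards0 ?addn0; last first.
  apply/setP => j; rewrite !inE; case: eqP => [->|]; by rewrite ?andbF.
apply: eq_card => j; rewrite !inE.
have [ji|nji] := boolP (j \in A i); last by rewrite andbF.
rewrite andbT /=.
have : (0 < #|column A j|)%N by apply/card_gt0P; exists i; rewrite in_column.
by have := col_le3 j; rewrite /column; case: #|_| => [|[|[|[|]]]].
Qed.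

Lemma card_line (i j : 'I_m) :
  (#|S2 :\: (S3 :|: A i :|: A j)| + #|A i :&: S2| + #|A j :&: S2|
   = #|S2| + #|A i :&: A j :&: S2|)%N.
Proof.
rewrite -addnA -cardsUI -setIUl addnA.
rewrite (_ : A i :&: S2 :&: (A j :&: S2) = A i :&: A j :&: S2); last first.
  by apply/setP => x; rewrite !inE; case: (x \in A i); case: (x \in A j); case: (_ == 2%N).
congr (_ + _)%N; rewrite -(cardsID (A i :|: A j) S2) addnC setIC; congr (_ + _)%N.
apply: eq_card => x; rewrite !inE -orbA negb_or.
case: (_ || _); rewrite ?andbF //= andbT.
by case: eqP => [->|]; rewrite ?andbF.
Qed.

Lemma card_line_cond (i j : 'I_m) (r : nat) :
  (#|A i :\: S3| + #|A j :\: S3| + #|S2 :\: (S3 :|: A i :|: A j)| + 2 * #|S3| <= 2 * r)%N ->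
  (#|A i :&: S1| + #|A j :&: S1| + #|S2| + #|A i :&: A j :&: S2| + 2 * #|S3| <= 2 * r)%N.
Proof. by rewrite !card_row; have := card_line i j; lia. Qed.

(** * The two cases and their Hall conditions *)

Section Cases.
Variable r : nat.
Hypothesis row_cond : forall i, (#|A i :\: S3| + #|S3| <= r)%N.
Hypothesis line_cond : forall i j, i != j ->
  (#|A i :\: S3| + #|A j :\: S3| + #|S2 :\: (S3 :|: A i :|: A j)| + 2 * #|S3| <= 2 * r)%N.
Hypothesis total_cond : (#|S1| + 2 * #|S2| + 3 * #|S3| <= 3 * r)%N.
Hypothesis crossing_cond : forall i j k l, uniq [:: i; j; k; l] ->
  (#|(A i :&: A j) :\: S3| + #|(A k :&: A l) :\: S3| + #|S3| <= r)%N.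

Lemma dep_free (s : nat) (f : 'I_s -> 'I_m) (l : 'I_s -> K) : (s <= 3)%N -> injective f ->
  (forall t, \sum_a l a * U (f a) t = 0) -> forall a, l a = 0.
Proof.
move=> s3 injf l0.
pose c i := \sum_(a | f a == i) l a.
have cE a : c (f a) = l a.
  by rewrite /c (big_pred1 a) // => b; rewrite /= (inj_eq injf).
suff c0 : forall i, c i = 0 by move=> a; rewrite -cE.
apply: (@dependency_small_support K m U gU (f @: setT)) => //.
- by rewrite card_imset // cardsT card_ord.
- move=> i ni; apply: big1 => a /eqP ai; case/negP: ni; apply/imsetP; by exists a.
move=> t; apply: etrans (l0 t); rewrite /c.
under eq_bigr => i _ do rewrite mulr_suml.
rewrite (exchange_big_dep xpredT) //=; apply: eq_bigr => a _.
by rewrite (big_pred1 (f a)) // => i; rewrite /= eq_sym.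
Qed.

(* Representatives: the columns [j] of [S1], with one block for each slot and one
   block [K^3] for each unused coordinate. *)
Lemma few_pairs_indep : (#|S3| + #|S2| <= r)%N ->
  exists V : 'M[K]_(n, r), tensor_indep U V (union_rows A).
Proof.
move=> few.
pose D := (r - (#|S3| + #|S2|))%N.
have er : (#|S3| + #|S2| + D = r)%N by rewrite /D; lia.
clearbody D.
pose beta (x : 'I_n + 'I_D * 'I_3) : 'I_n + 'I_D :=
  match x with inl h => inl h | inr da => inr da.1 end.
pose g j (x : 'I_n + 'I_D * 'I_3) := match x with
  | inl h => if h \in S2 then bracket U (p h) (q h) (p j) else 0
  | inr da => U (p j) da.2
  end.
have [|c cP] := @rado_blocks K _ _ _ beta g S1.
  move=> Q QS1; rewrite big_sumType /=.
  set F1 := (\sum_h _)%N; set F2 := (\sum_d _)%N.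
  have F2_ge (s : nat) (f : 'I_s -> 'I_n) : (s <= 3)%N -> (forall a, f a \in Q) ->
      injective (fun a => p (f a)) -> (D * s <= F2)%N.
    move=> s3 fQ injf; rewrite -[X in (X * s)%N](card_ord D) -sum_nat_const.
    apply: leq_sum => d _; apply: (block_rank_ge fQ) => l l0.
    apply: (dep_free s3 injf) => t.
    by apply: etrans (l0 (inr (d, t)) erefl).
  (* A slot has rank at least 1 unless its column contains every point [p j] with [j] in [Q]. *)
  have F1_ge (W : {set 'I_n}) :
      (forall h, h \in S2 -> (forall j, j \in Q -> p j \in column A h) -> h \in W) ->
      (#|S2 :\: W| <= F1)%N.
    move=> HW; rewrite -[X in (X <= _)%N]addn0 -(@cards0 'I_n).
    apply: sum_ge_card2 => h; rewrite in_set0 addn0 inE.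
    case: (boolP (h \in S2)) => [hS2|]; last by rewrite andbF.
    rewrite andbT; case: (boolP (h \in W)) => // hW /=.
    have [/existsP[j /andP[jQ jh]]|/existsPn no] :=
        boolP [exists j, (j \in Q) && (p j \notin column A h)]; last first.
      case/negP: hW; apply: HW => // j jQ; have := no j.
      by rewrite jQ /= negbK.
    apply: (@block_rank_ge K _ _ _ beta g Q (inl h) 1 (fun=> j)) => // l l0 a.
    have := l0 (inl h) erefl; rewrite big_ord1 /g hS2 => /eqP.
    have [pq colh] := col2 hS2.
    move: jh; rewrite colh !inE negb_or => /andP[jp jq].
    rewrite mulf_eq0 (negbTE (bracket_neq0 gU _ _ _)) // 1?eq_sym // orbF.
    by rewrite (ord1 a) => /eqP.
  have [->|[j1 j1Q]] := set_0Vmem Q; first by rewrite cards0.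
  have pA j : j \in Q -> j \in A (p j).
    by move=> jQ; rewrite -in_column (col1 (subsetP QS1 _ jQ)) inE.
  (* The cases are one, two, or at least three distinct points [p j], settled by the row, line and
     total conditions. In the last case no slot is lost, as its column has only two elements. *)
  have [/existsP[j2 /andP[j2Q j21]]|/existsPn one] :=
      boolP [exists j, (j \in Q) && (p j != p j1)]; last first.
    have pE j : j \in Q -> p j = p j1.
      by move=> jQ; have := one j; rewrite jQ negbK => /eqP.
    have := F1_ge (A (p j1) :&: S2); have := F2_ge 1%N (fun=> j1) isT (fun=> j1Q).
    move=> /(_ (fun a b _ => etrans (ord1 a) (esym (ord1 b)))) HF2 HF1.
    have {}HF1 : (#|S2 :\: (A (p j1) :&: S2)| <= F1)%N.
      by apply: HF1 => h hS2 H; rewrite inE hS2 -in_column H.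
    have cQ : (#|Q| <= #|A (p j1) :&: S1|)%N.
      apply/subset_leq_card/subsetP => j jQ.
      by rewrite inE (subsetP QS1) // -(pE j) // pA.
    have := row_cond (p j1); rewrite card_row.
    have := cardsID (A (p j1) :&: S2) S2; rewrite (setIidPr (subsetIr _ _)).
    card_lia.
  have [/existsP[j3 /and3P[j3Q j31 j32]]|/existsPn two] :=
      boolP [exists j, [&& j \in Q, p j != p j1 & p j != p j2]]; last first.
    have pE j : j \in Q -> p j = p j1 \/ p j = p j2.
      move=> jQ; have := two j; rewrite jQ /= negb_and !negbK.
      by case/orP => /eqP; [left | right].
    have HF2 : (D * 2 <= F2)%N.
      apply: (F2_ge 2%N (fun a => if a == ord0 then j1 else j2)) => //.
        by move=> a; case: ifP.
      move=> a b; case: (eqVneq a ord0) => [->|a0]; case: (eqVneq b ord0) => [->|b0] //.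
      - by move/eqP; rewrite eq_sym (negbTE j21).
      - by move/eqP; rewrite (negbTE j21).
      by move=> _; apply: val_inj; case: a a0 => [[|[|]]] //; case: b b0 => [[|[|]]].
    have HF1 : (#|S2 :\: (A (p j1) :&: A (p j2) :&: S2)| <= F1)%N.
      by apply: F1_ge => h hS2 H; rewrite !in_setI hS2 -!in_column !H.
    have cQ : (#|Q| <= #|A (p j1) :&: S1| + #|A (p j2) :&: S1|)%N.
      apply: leq_trans (leq_card_setU _ _); apply/subset_leq_card/subsetP => j jQ.
      rewrite !in_setU !in_setI (subsetP QS1) // !andbT.
      by case: (pE j jQ) => <-; rewrite pA ?orbT.
    have := card_line_cond (line_cond j21).
    have := cardsID (A (p j1) :&: A (p j2) :&: S2) S2; rewrite (setIidPr (subsetIr _ _)).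
    rewrite (setIC (A (p j2)) (A (p j1))); card_lia.
  have HF2 : (D * 3 <= F2)%N.
    apply: (F2_ge 3%N (fun a => if a == o0 then j1 else if a == o1 then j2 else j3)) => //.
      by move=> a; do 2?case: ifP.
    move=> a b; elim/ord3_ind: a; elim/ord3_ind: b => //= /eqP;
    by rewrite ?(negbTE j21) ?(negbTE j31) ?(negbTE j32) // eq_sym
      ?(negbTE j21) ?(negbTE j31) ?(negbTE j32).
  have HF1 : (#|S2 :\: set0| <= F1)%N.
    apply: F1_ge => h hS2 H.
    have sub : [set p j1; p j2; p j3] \subset column A h by rewrite !subUset !sub1set !H.
    have := subset_leq_card sub; move: hS2; rewrite mem_in_exactly => /eqP->.
    by rewrite -setUA cardsU1 cards2 !inE negb_or ![p j1 == _]eq_sym [p j2 == p j3]eq_sym j21 j31 j32.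
  have := subset_leq_card QS1; rewrite setD0 in HF1.
  card_lia.
apply: (@slot_criterion r S2 D (fun s j => if j \in S1 then c j s else 0)) => //.
move=> C suppC C23 Ch Cd.
(* A column [j] of [S1] has the single row [p j], so the sum over rows has one term. *)
have collapse (k : 'I_n -> K) (f : 'I_m -> K) :
    \sum_i \sum_j (if j \in S1 then k j else 0) * (C i j * f i) =
    \sum_(j in S1) C (p j) j * (k j * f (p j)).
  rewrite exchange_big [RHS]big_mkcond; apply: eq_bigr => j _ /=.
  case: (boolP (j \in S1)) => jS1; last by apply: big1 => i _; rewrite mul0r.
  rewrite (bigD1 (p j)) //= big1 ?addr0 => [|i ip]; first by ring.
  rewrite suppC ?mul0r ?mulr0 // -in_column col1 // inE //.
have C1 j : j \in S1 -> C (p j) j = 0.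
  apply: (cP (fun j => C (p j) j)) => -[h|[d a]] /=.
    case: (boolP (h \in S2)) => hS2; last by apply: big1 => j' _; rewrite !mulr0.
    exact: etrans (esym (collapse (c^~ (inl h)) (bracket U (p h) (q h)))) (Ch h hS2).
  exact: etrans (esym (collapse (c^~ (inr d)) (fun i => U i a))) (Cd d a).
move=> i j; have [ji|/suppC //] := boolP (j \in A i).
have [j23|j23] := boolP (j \in S3 :|: S2); first exact: C23.
have jS1 : j \in S1.
  have : (0 < #|column A j|)%N by apply/card_gt0P; exists i; rewrite in_column.
  move: j23 (col_le3 j); rewrite in_setU !mem_in_exactly.
  by case: #|_| => [|[|[|[|]]]].
move: ji; rewrite -in_column col1 // inE => /eqP ->; exact: C1.
Qed.

Lemma column_card k j : j \in in_exactly A k -> #|column A j| = k.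
Proof. by rewrite mem_in_exactly => /eqP. Qed.

Lemma nonconcurrent_columns h h' j : h \in S2 -> h' \in S2 -> j \in S2 ->
  column A h != column A h' -> column A h != column A j ->
  column A h' != column A j ->
  column A h :&: column A h' :&: column A j = set0 ->
  concurrency U (p h) (q h) (p h') (q h') (p j) (q j) != 0.
Proof.
move=> /col2[pq1 ->] /col2[pq2 ->] /col2[pq3 ->] n12 n13 n23 no.
exact: (concurrency_neq0 gU).
Qed.

(* Representatives: the slots [h], with one block for each extra column and [D]
   dummy blocks of dimension 1 which make the system square, so that its rows
   being independent forces its columns to be. The forms of [Q] have full rank on
   all extra columns unless the lines of [Q] are equal, or meet in a vertex, or
   are only two lines without common vertex. *)
Lemma many_pairs_indep : (r <= #|S3| + #|S2|)%N ->
  exists V : 'M[K]_(n, r), tensor_indep U V (union_rows A).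
Proof.
move=> many.
have S3r : (#|S3| <= r)%N.
  have i0 : 'I_m by apply: (@Ordinal m 0); lia.
  by have := row_cond i0; lia.
have [H HS2 cH] := @subset_of_card _ S2 (r - #|S3|) (ltac:(lia)).
set G := S2 :\: H.
have GS2 : G \subset S2 by apply: subsetDl.
have cS2 : (#|H| + #|G| = #|S2|)%N by rewrite -(cardsID H S2) (setIidPr HS2).
(* The extra columns have [#|S1| + 2 * #|G|] cells; [D] is the number of slots in excess of this,
   and the subtraction does not truncate by the total condition. *)
pose D := (r - #|S3| - (#|S1| + 2 * #|G|))%N.
have eD : (#|S1| + 2 * #|G| + D = #|H|)%N by rewrite /D; card_lia.
clearbody D.
pose beta (x : 'I_m * 'I_n + 'I_D) : 'I_n + 'I_D :=
  match x with inl ij => inl ij.2 | inr d => inr d end.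
pose cells := [set ij : 'I_m * 'I_n | (ij.2 \in A ij.1) && (ij.2 \in S1 :|: G)].
(* On block [j], row [h] is the restriction to [L_j] of the form with kernel [L_h], given by its
   values at the [u_i] of the column. *)
pose g h (x : 'I_m * 'I_n + 'I_D) := match x with
  | inl ij => if ij \in cells then bracket U (p h) (q h) ij.1 else 0
  | inr d => 1
  end.
have [|c cP] := @rado_blocks K _ _ _ beta g H.
  move=> Q QH; rewrite big_sumType /=.
  set F1 := (\sum_j _)%N; set F2 := (\sum_d _)%N.
  have [->|[h0 h0Q]] := set_0Vmem Q; first by rewrite cards0.
  have QS2 h : h \in Q -> h \in S2 by move/(subsetP QH)/(subsetP HS2).
  have F2_ge : (D <= F2)%N.
    rewrite -[X in (X <= _)%N](card_ord D) -sum1_card; apply: leq_sum => d _.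
    apply: (@block_rank_ge K _ _ _ beta g Q (inr d) 1 (fun=> h0)) => // l l0 a.
    by have := l0 (inr d) erefl; rewrite big_ord1 /g mulr1 (ord1 a).
  have b1 j i h : h \in Q -> j \in S1 :|: G -> i \in column A j -> i \notin column A h ->
      (1 <= block_rank beta g Q (inl j))%N.
    move=> hQ jSG ij ih.
    apply: (@block_rank_ge K _ _ _ beta g Q (inl j) 1 (fun=> h)) => // l l0 a.
    have := l0 (inl (i, j)) erefl; rewrite big_ord1 /g inE /= jSG -in_column ij => /eqP.
    have [pq colh] := col2 (QS2 h hQ).
    move: ih; rewrite colh !inE negb_or => /andP[ip iq].
    rewrite mulf_eq0 (negbTE (bracket_neq0 gU _ _ _)) // 1?eq_sym // orbF.
    by rewrite (ord1 a) => /eqP.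
  have b1G j h : h \in Q -> j \in G -> column A j != column A h ->
      (1 <= block_rank beta g Q (inl j))%N.
    move=> hQ jG ne.
    have /subsetPn[i ij ih] : ~~ (column A j \subset column A h).
      apply: contra ne => sub; rewrite eqEcard sub.
      by rewrite (column_card (QS2 h hQ)) (column_card (subsetP GS2 j jG)).
    by apply: (b1 j i h) => //; rewrite inE jG orbT.
  (* The 2 by 2 determinant of the two forms on [L_j] is the [concurrency] of the three lines. *)
  have b2 j h h' : h \in Q -> h' \in Q -> j \in G ->
      column A h != column A h' -> column A h != column A j ->
      column A h' != column A j ->
      column A h :&: column A h' :&: column A j = set0 ->
      (2 <= block_rank beta g Q (inl j))%N.
    move=> hQ h'Q jG n12 n13 n23 no.
    have jS2 := subsetP GS2 j jG.
    have := nonconcurrent_columns (QS2 h hQ) (QS2 h' h'Q) jS2 n12 n13 n23 no.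
    have [pqj colj] := col2 jS2.
    rewrite /concurrency => det0.
    apply: (@block_rank_ge K _ _ _ beta g Q (inl j) 2 (fun a => if a == ord0 then h else h')).
      by move=> a; case: ifP.
    move=> l l0.
    have cell i : i \in column A j -> (i, j) \in cells.
      by move=> ij; rewrite inE /= -in_column ij inE jG orbT.
    have := l0 (inl (p j, j)) erefl; have := l0 (inl (q j, j)) erefl.
    rewrite /g !big_ord_recl !big_ord0 /= !cell ?colj ?inE ?eqxx ?orbT //= !addr0.
    set x := l _; set y := l _ => eq1 eq2.
    have x0 : x = 0.
      apply/eqP; have : x * (bracket U (p h) (q h) (p j) * bracket U (p h') (q h') (q j) -
        bracket U (p h) (q h) (q j) * bracket U (p h') (q h') (p j)) = 0.
        transitivity ((x * bracket U (p h) (q h) (p j) + y * bracket U (p h') (q h') (p j))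
            * bracket U (p h') (q h') (q j)
          - (x * bracket U (p h) (q h) (q j) + y * bracket U (p h') (q h') (q j))
            * bracket U (p h') (q h') (p j)); first by ring.
        by rewrite eq1 eq2 !mul0r subr0.
      by move/eqP; rewrite mulf_eq0 (negbTE det0) orbF.
    have y0 : y = 0.
      apply/eqP; have : y * (bracket U (p h) (q h) (p j) * bracket U (p h') (q h') (q j) -
        bracket U (p h) (q h) (q j) * bracket U (p h') (q h') (p j)) = 0.
        transitivity ((x * bracket U (p h) (q h) (q j) + y * bracket U (p h') (q h') (q j))
            * bracket U (p h) (q h) (p j)
          - (x * bracket U (p h) (q h) (p j) + y * bracket U (p h') (q h') (p j))
            * bracket U (p h) (q h) (q j)); first by ring.
        by rewrite eq1 eq2 !mul0r subr0.
      by move/eqP; rewrite mulf_eq0 (negbTE det0) orbF.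
    move=> a; have [->|->] : a = ord0 \/ a = lift ord0 ord0.
      by case: a => [[|[|]]] // lt; [left | right]; apply: val_inj.
    - exact: x0.
    - exact: y0.
  have F1_ge (T1 T2 T3 : {set 'I_n}) : T1 \subset S1 -> T2 \subset G -> T3 \subset T2 ->
      (forall j, j \in T1 :|: T2 -> 1 <= block_rank beta g Q (inl j))%N ->
      (forall j, j \in T3 -> 2 <= block_rank beta g Q (inl j))%N ->
      (#|T1| + #|T2| + #|T3| <= F1)%N.
    move=> sT1 sT2 sT3 r1 r2.
    have -> : (#|T1| + #|T2| = #|T1 :|: T2|)%N.
      rewrite -cardsUI (_ : T1 :&: T2 = set0) ?cards0 ?addn0 //.
      apply/setP => j; rewrite [RHS]in_set0 in_setI; apply/negP => /andP[/(subsetP sT1) j1].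
      by move=> /(subsetP sT2)/(subsetP GS2); rewrite S12_disjoint.
    apply: sum_ge_card2 => j.
    case: (boolP (j \in T3)) => j3.
      by rewrite inE (subsetP sT3) // orbT; apply: r2.
    by rewrite addn0; case: (boolP (j \in T1 :|: T2)) => // /r1.
  have S1G j : j \in S1 -> j \in S1 :|: G by move=> jS1; rewrite inE jS1.
  have pS1 j : j \in S1 -> p j \in column A j by move=> jS1; rewrite col1 // inE.
  have splitG (X : {set 'I_n}) : (#|H :&: X| + #|G :&: X| = #|X :&: S2|)%N.
    rewrite -(cardsID H (X :&: S2)); congr (_ + _)%N; apply: eq_card => x.
      rewrite !in_setI; case: (boolP (x \in H)) => [/(subsetP HS2)->|]; by rewrite ?andbT ?andbF.
    by rewrite !(in_setI, in_setD) andbAC andbA [x \in X]lock andbC -lock andbA.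
  (* If all lines of [Q] coincide, say with [ab], blocks of [S1] away from [a] and [b] and blocks of
     [G] on other lines have rank at least 1; the line condition for [a], [b] concludes. *)
  have [/existsP[h1 /andP[h1Q h10]]|/existsPn one] :=
      boolP [exists h, (h \in Q) && (column A h != column A h0)]; last first.
    have colE h : h \in Q -> column A h = column A h0.
      by move=> hQ; have := one h; rewrite hQ negbK => /eqP.
    have [pq col0] := col2 (QS2 _ h0Q).
    set a := p h0 in pq col0; set b := q h0 in pq col0.
    have inab h : h \in Q -> (h \in A a) && (h \in A b).
      by move=> hQ; rewrite -!in_column colE // col0 !inE !eqxx orbT.
    have cQ : (#|Q| <= #|H :&: (A a :&: A b)|)%N.
      apply/subset_leq_card/subsetP => h hQ.
      by rewrite !in_setI (subsetP QH) // inab.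
    have := F1_ge (S1 :\: (A a :|: A b)) (G :\: (A a :&: A b)) set0 (subsetDl _ _) (subsetDl _ _) (sub0set _).
    rewrite cards0 addn0 => /(_ _ _)/wrap[] => [j|j|HF1].
    - rewrite inE => /orP[]; rewrite in_setD => /andP[].
        rewrite in_setU => nab jS1; apply: (b1 j (p j) h0) => //; rewrite ?S1G ?pS1 //.
        apply: contra nab; rewrite col0 !inE => /orP[]/eqP e;
          by have := pS1 j jS1; rewrite in_column e => ->; rewrite ?orbT.
      move=> nab jG; apply: (b1G j h0) => //; apply: contra nab => /eqP e.
      by rewrite in_setI -!in_column e col0 !inE !eqxx orbT.
    - by rewrite in_set0.
    have := card_line_cond (line_cond pq).
    have := splitG (A a :&: A b).
    have := cardsID (A a :|: A b) S1; have := cardsID (A a :&: A b) G.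
    have : (#|S1 :&: (A a :|: A b)| <= #|A a :&: S1| + #|A b :&: S1|)%N.
      rewrite setIC setIUl; exact: leq_card_setU.
    card_lia.
  (* If distinct lines of [Q] all pass through [a], blocks of [G] have rank at least 1, and at least
     2 when off [a]; the row condition for [a] concludes. *)
  have [/existsP[a /forallP allA]|/existsPn noA] :=
      boolP [exists a, [forall h, (h \in Q) ==> (h \in A a)]].
    have {}allA h : h \in Q -> a \in column A h.
      by move=> hQ; rewrite in_column; have := allA h; rewrite hQ.
    have only x : x \in column A h0 -> x \in column A h1 -> x = a.
      move=> x0 x1; apply/eqP; apply: contraNT h10 => xa; apply/eqP/esym.
      by apply: (@two_set_eq _ _ _ x a) => //; rewrite ?allA // (column_card (QS2 _ _)).
    have cQ : (#|Q| <= #|H :&: A a|)%N.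
      apply/subset_leq_card/subsetP => h hQ.
      by rewrite in_setI (subsetP QH) //= -in_column allA.
    have := F1_ge (S1 :\: A a) G (G :\: A a) (subsetDl _ _) (subxx _) (subsetDl _ _).
    move=> /(_ _ _)/wrap[] => [j|j|HF1].
    - rewrite inE => /orP[|jG].
        rewrite in_setD => /andP[ja jS1].
        have pja : p j != a by apply: contraNneq ja => <-; rewrite -in_column pS1.
        have [p0|p0] := boolP (p j \in column A h0); last first.
          by apply: (b1 j (p j) h0); rewrite ?S1G ?pS1.
        apply: (b1 j (p j) h1); rewrite ?S1G ?pS1 //.
        by apply: contra pja => p1; apply/eqP/only.
      have [e0|ne0] := eqVneq (column A j) (column A h0); last exact: (b1G j h0).
      by apply: (b1G j h1) => //; rewrite e0 eq_sym.
    - rewrite in_setD => /andP[ja jG]; apply: (b2 j h0 h1) => //.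
      + by rewrite eq_sym.
      + by apply: contraNneq ja => e; rewrite -in_column -e allA.
      + by apply: contraNneq ja => e; rewrite -in_column -e allA.
      apply/setP => x; rewrite [RHS]in_set0 !in_setI; apply/negP => /andP[/andP[x0 x1] xj].
      by case/negP: ja; rewrite -in_column -(only x).
    have := row_cond a; rewrite card_row; have := splitG (A a).
    have := cardsID (A a) S1; have := cardsID (A a) G; rewrite (setIC S1).
    card_lia.
  have {}noA a : exists2 h, h \in Q & a \notin column A h.
    have := noA a; rewrite negb_forall => /existsP[h]; rewrite negb_imply => /andP[hQ ha].
    by exists h; rewrite ?in_column.
  have rk1 j : j \in S1 :|: G -> (1 <= block_rank beta g Q (inl j))%N.
    rewrite inE => /orP[jS1|jG].
      by have [h hQ ph] := noA (p j); apply: (b1 j (p j) h); rewrite ?S1G ?pS1.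
    have [e0|ne0] := eqVneq (column A j) (column A h0); last exact: (b1G j h0).
    by apply: (b1G j h1) => //; rewrite e0 eq_sym.
  (* With three distinct lines and no common vertex every block has full rank, and the bound is just
     that [Q] lies in [H]. *)
  have [/existsP[h2 /and3P[h2Q h20 h21]]|/existsPn two] :=
      boolP [exists h, [&& h \in Q, column A h != column A h0 & column A h != column A h1]].
    have HF1 : (#|S1| + #|G| + #|G| <= F1)%N.
      apply: F1_ge => // j jG.
      have [h [h' [hQ h'Q hh' hj h'j]]] : exists h h', [/\ h \in Q, h' \in Q,
          column A h != column A h', column A h != column A j & column A h' != column A j].
        have [e0|ne0] := eqVneq (column A h0) (column A j).
          by exists h1, h2; rewrite -e0; split=> //; rewrite eq_sym.
        have [e1|ne1] := eqVneq (column A h1) (column A j).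
          by exists h0, h2; rewrite -e1; split=> //; rewrite eq_sym.
        by exists h0, h1; split=> //; rewrite eq_sym.
      have [no|[x]] := set_0Vmem (column A h :&: column A h' :&: column A j).
        exact: (b2 j h h').
      rewrite !in_setI => /andP[/andP[xh xh'] xj].
      (* A line [k] avoiding the common vertex [x] replaces [h']: a vertex shared by [k], [h] and
         [j] would differ from [x], forcing [h] and [j] to be the same line. *)
      have [k kQ xk] := noA x.
      have kj : column A k != column A j by apply: contraNneq xk => ->.
      have kh : column A k != column A h by apply: contraNneq xk => ->.
      apply: (b2 j k h) => //; apply/setP => y; rewrite [RHS]in_set0 !in_setI.
      apply/negP => /andP[/andP[yk yh] yj].
      have xy : x != y by apply: contraNneq xk => ->.
      case/eqP: hj; apply: (@two_set_eq _ _ _ x y) => //.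
        exact: (column_card (QS2 h hQ)).
      exact: (column_card (subsetP GS2 j jG)).
    have := subset_leq_card QH; card_lia.
  have colE h : h \in Q -> column A h = column A h0 \/ column A h = column A h1.
    move=> hQ; have := two h; rewrite hQ /= negb_and !negbK.
    by case/orP => /eqP; [left | right].
  (* What remains is two disjoint lines. Only columns of [G] on one of them may fall short of rank
     2, and the crossing condition makes up for these. *)
  have disj x : x \in column A h0 -> x \notin column A h1.
    move=> x0; apply/negP => x1; have [h hQ] := noA x.
    by case: (colE h hQ) => ->; rewrite ?x0 ?x1.
  have [pq0 col0] := col2 (QS2 _ h0Q); have [pq1 col1'] := col2 (QS2 _ h1Q).
  set a := p h0 in pq0 col0; set b := q h0 in pq0 col0.
  set a' := p h1 in pq1 col1'; set b' := q h1 in pq1 col1'.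
  have uab : uniq [:: a; b; a'; b'].
    have := disj a; have := disj b; rewrite col0 col1' !inE !eqxx orbT /=.
    rewrite !negb_or => /(_ isT)/andP[-> ->] /(_ isT)/andP[-> ->].
    by rewrite pq0 pq1.
  have cQ : (#|Q| <= #|H :&: (A a :&: A b)| + #|H :&: (A a' :&: A b')|)%N.
    apply: leq_trans (leq_card_setU _ _); apply/subset_leq_card/subsetP => h hQ.
    rewrite in_setU !in_setI (subsetP QH) //= -!in_column.
    by case: (colE h hQ) => ->; rewrite ?col0 ?col1' !inE !eqxx !orbT.
  have HF1 : (#|S1| + #|G| + #|G :\: (A a :&: A b :|: A a' :&: A b')| <= F1)%N.
    apply: F1_ge => //; first exact: subsetDl.
    move=> j; rewrite in_setD in_setU negb_or => /andP[/andP[nj0 nj1] jG].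
    apply: (b2 j h0 h1) => //.
    - by rewrite eq_sym.
    - apply: contra nj0 => /eqP e; by rewrite in_setI -!in_column -e col0 !inE !eqxx orbT.
    - apply: contra nj1 => /eqP e; by rewrite in_setI -!in_column -e col1' !inE !eqxx orbT.
    apply/setP => x; rewrite [RHS]in_set0 !in_setI; apply/negP => /andP[/andP[x0 x1] _].
    by move/negP: (disj x x0).
  have sub (X : {set 'I_n}) : (#|X :&: S2| <= #|X :\: S3|)%N.
    apply/subset_leq_card/subsetP => x; rewrite in_setI in_setD => /andP[->].
    by rewrite !mem_in_exactly => /eqP->.
  have := crossing_cond uab; have := sub (A a :&: A b); have := sub (A a' :&: A b').
  have := splitG (A a :&: A b); have := splitG (A a' :&: A b').
  have := cardsID (A a :&: A b :|: A a' :&: A b') G.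
  have : (#|G :&: (A a :&: A b :|: A a' :&: A b')| <= #|G :&: (A a :&: A b)| + #|G :&: (A a' :&: A b')|)%N.
    rewrite setIUr; exact: leq_card_setU.
  card_lia.
(* [S3] and the slots use up all coordinates of [K^r]; the dummy blocks are not coordinates. *)
have er : (#|S3| + #|H| + 0 = r)%N by lia.
apply: (@slot_criterion r H 0 (fun s j => match s with inl h => c h (inl j) | inr _ => 0 end)) => //.
move=> C suppC C3H Ch _.
have cellsP i j : (i, j) \notin cells -> C i j = 0.
  rewrite inE /=; have [ji|/suppC //] := boolP (j \in A i); rewrite /= => nj.
  apply: C3H; have : (0 < #|column A j|)%N by apply/card_gt0P; exists i; rewrite in_column.
  move: nj (col_le3 j); rewrite !in_setU in_setD !mem_in_exactly.
  by case: (j \in H); rewrite ?orbT //=; case: #|_| => [|[|[|[|]]]].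
pose Y := [set x : 'I_m * 'I_n + 'I_D | if x is inl ij then ij \in cells else true].
(* The unknowns are the coefficients at the cells, padded with 0 at the dummy blocks. *)
pose u (x : 'I_m * 'I_n + 'I_D) := if x is inl ij then C ij.1 ij.2 else 0.
pose M h x := c h (beta x) * g h x.
have cY : (#|Y| <= #|H|)%N.
  have -> : #|Y| = (#|cells| + D)%N.
    rewrite -sum1_card big_mkcond big_sumType /=; congr (_ + _)%N.
      by rewrite -sum1_card [RHS]big_mkcond; apply: eq_bigr => ij _; rewrite inE.
    by rewrite -[RHS](card_ord D) -sum1_card; apply: eq_bigr => d _; rewrite inE.
  have -> : (#|cells| = \sum_(j in S1 :|: G) #|column A j|)%N.
    rewrite -sum1_card (eq_bigl (fun ij => (ij.2 \in A ij.1) && (ij.2 \in S1 :|: G))); last first.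
      by move=> ij; rewrite inE.
    rewrite -(pair_big_dep xpredT (fun i j => (j \in A i) && (j \in S1 :|: G)) (fun=> fun=> 1%N)) /=.
    rewrite (exchange_big_dep (mem (S1 :|: G))) /=; last by move=> i j _ /andP[].
    by apply: eq_bigr => j jSG; rewrite -sum1_card; apply: eq_bigl => i; rewrite jSG andbT inE.
  rewrite -eD leq_add2r (big_setID S1) /=; apply: leq_add.
    rewrite (eq_bigr (fun=> 1%N)) => [|j]; last first.
      by rewrite in_setI => /andP[_ /column_card].
    by rewrite sum1_card subset_leq_card // subsetIr.
  rewrite (eq_bigr (fun=> 2%N)) => [|j]; last first.
    rewrite in_setD in_setU => /andP[/negbTE->] /= /(subsetP GS2); exact: column_card.
  rewrite sum_nat_const mulnC leq_mul2l subset_leq_card ?orbT //.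
  by apply/subsetP => j; rewrite in_setD in_setU => /andP[/negbTE->].
(* Rows are indexed by slots and columns by cells and dummies, so [cP] is injectivity on the side
   opposite to the one needed. *)
have u0 := @square_dual K _ _ H Y M cY _ u _.
move=> i j; have [ijc|/cellsP //] := boolP ((i, j) \in cells).
apply: (u0 _ _ (inl (i, j))); last by rewrite inE.
  move=> l l0; apply: cP => x; have [/l0 //|] := boolP (x \in Y).
  case: x => [ij|d]; rewrite inE // => /negbTE nij.
  by apply: big1 => h _; rewrite /= nij !mulr0.
move=> h hH; rewrite big_mkcond big_sumType /= [X in _ + X]big1 ?addr0; last first.
  by move=> d _; rewrite mulr0 if_same.
apply: etrans (Ch h hH); rewrite pair_bigA; apply: eq_bigr => -[i' j'] _ /=.
rewrite inE; case: (boolP ((i', j') \in cells)) => [cell|/cellsP->]; last by rewrite mul0r mulr0.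
rewrite /M /= cell; ring.
Qed.
End Cases.
End Sufficiency.

(* Assembling the equivalence *)
Local Close Scope ring_scope.

Theorem proposition3p4
  (m n r p : nat) (hm : 3 <= m) (hr : r <= n) (hp : p = 0 \/ prime p)
  (K : fieldType) (hK : has_char K p)
  (U : 'M[K]_(m, 3)) (V : 'M[K]_(n, r)) (hUV : generic_vectors U V)
  (A : 'I_m -> {set 'I_n}) (hA : forall i : 'I_m, #|A i| <= r) :
  let S1 := in_exactly A 1 in
  let S2 := in_exactly A 2 in
  let S3 := in_exactly A 3 in
  tensor_indep U V (union_rows A) <->
  [/\ forall i j k l : 'I_m, uniq [:: i; j; k; l] ->
        #|A i :&: A j :&: A k :&: A l| = 0,
      forall i : 'I_m, #|A i :\: S3| + #|S3| <= r,
      forall i j k l : 'I_m, uniq [:: i; j; k; l] ->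
        #|(A i :&: A j) :\: S3| + #|(A k :&: A l) :\: S3| + #|S3| <= r,
      forall i j : 'I_m, i != j ->
        #|A i :\: S3| + #|A j :\: S3| + #|S2 :\: (S3 :|: A i :|: A j)|
          + 2 * #|S3| <= 2 * r
    & #|S1| + 2 * #|S2| + 3 * #|S3| <= 3 * r].
Proof.
move=> S1 S2 S3; have gU := generic_general_position hUV.
split=> [indep|[quad row cross line total]].
  split.
  - exact/column_le3P/(indep_column_le3 gU indep).
  - exact: (indep_row_bound hm gU indep).
  - exact: (indep_crossing_bound hm gU indep).
  - exact: (indep_line_bound hm gU indep).
  - exact: (indep_total_bound gU indep).
have le3 := (column_le3P A).1 quad.
(* The pair lists the elements of a column of [S1] or [S2], with a repetition for [S1]; on other
   columns its value is arbitrary. *)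
have /fin_all_exists[e eP] : forall j, exists e : 'I_m * 'I_m,
    (j \in S1 -> column A j = [set e.1]) /\
    (j \in S2 -> e.1 != e.2 /\ column A j = [set e.1; e.2]).
  move=> j; case: (boolP (j \in S1)) => [|_].
    move=> j1; have /cards1P[i ei] : #|column A j| == 1 by rewrite (column_card j1).
    by exists (i, i); split=> // j2; have := column_card j2; rewrite (column_card j1).
  case: (boolP (j \in S2)) => [j2|_].
    have /cards2P[a [b ab]] : #|column A j| == 2 by rewrite (column_card j2).
    by exists (a, b); split.
  by have i0 : 'I_m by [apply: (@Ordinal m 0); lia]; exists (i0, i0).
have col1 j : j \in S1 -> column A j = [set (e j).1] by case: (eP j).
have col2 j : j \in S2 -> (e j).1 != (e j).2 /\ column A j = [set (e j).1; (e j).2].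
  by case: (eP j).
(* One good [V'] for the given [U] is enough, since independence at [(U, V')] carries over to the
   generic [(U, V)]. *)
have [V' indep'] : exists V' : 'M[K]_(n, r), tensor_indep U V' (union_rows A).
  have [few|many] := leqP (#|S3| + #|S2|) r.
    exact: (few_pairs_indep hm gU le3 col1 col2).
  exact: (many_pairs_indep hm gU le3 col1 col2 row line total cross (ltnW many)).
exact: (generic_tensor_indep hUV indep').
Qed.
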